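(* Let $(G,\cdot)$ be a finitely-generated, torsion-free, nilpotent group. If some automorphism of $G$ satisfies an identity of degree $m$ that is arithmetically-free over $\mathbb{Q}$, then $G$ is nilpotent of class at most $m^{2^m}$.
   Context: Identities: an automorphism $f$ of a group $G$ satisfies an identity if there are constants $k\in\mathbb{N}$ and $m_1,\ldots,m_k,n_1,\ldots,n_k\in\mathbb{Z}$ such that for all $x\in G$, $$1_G=f^{m_1}(x^{n_1})\cdot f^{m_2}(x^{n_2})\cdots f^{m_k}(x^{n_k}).$$ The degree of the identity is $m=\max\{|m_s-m_t| \mid 1\leq s,t\leq k\}$. To this identity and a field $\mathbb{F}$ one associates the Laurent-polynomial $r_{\mathbb{F}}(z)=\sum_{1\leq t\leq k}n_t\cdot z^{m_t}\in\mathbb{F}[z,z^{-1}]$. The identity is arithmetically-free over $\mathbb{F}$ iff the set of roots of $r_{\mathbb{F}}(z)$ in $\overline{\mathbb{F}}^\times$ is an arithmetically-free subset of the multiplicative group $(\overline{\mathbb{F}}^\times,\cdot)$, where $\overline{\mathbb{F}}$ is an algebraic closure of $\mathbb{F}$. Arithmetically-free: a finite subset $X$ of an abelian group $(A,\cdot)$ is arithmetically-free iff there are no $x\in X$, $y\in X$ with $x\langle y\rangle\subseteq X$, where $\langle y\rangle$ is the cyclic subgroup generated by $y$. In particular arithmetically-free sets are finite (so $r_{\mathbb{F}}\neq 0$). *)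

(* Defs.v *)
From HB Require Import structures.
From mathcomp Require Import all_boot all_order all_algebra all_field.
From mathcomp Require Import monalg.

Set Implicit Arguments.
Unset Strict Implicit.
Unset Printing Implicit Defensive.

Import GRing.Theory.

(* Groups are [groupType]s, possibly infinite and non-commutative; subsets of *)
(* a group are [Prop]-valued since membership need not be decidable.          *)

Section Groups.
Local Open Scope group_scope.

Definition expgz (G : groupType) (x : G) (i : int) : G :=
  match i with Posz n => x ^+ n | Negz n => x ^- n.+1 end.

Inductive generated (G : groupType) (S : G -> Prop) : G -> Prop :=
| generated_in x : S x -> generated S x
| generated_one : generated S 1
| generated_mul x y : generated S x -> generated S y -> generated S (x * y)
| generated_inv x : generated S x -> generated S x^-1.

Definition finitely_generated (G : groupType) : Prop :=
  exists s : seq G, forall x : G, generated (fun y => y \in s) x.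

Definition torsion_free (G : groupType) : Prop :=
  forall (x : G) (n : nat), (0 < n)%N -> x ^+ n = 1 -> x = 1.

(* [lower_central G i] is the (i+1)-st term of the lower central series.      *)
Fixpoint lower_central (G : groupType) (i : nat) : G -> Prop :=
  if i is j.+1 then
    generated (fun z => exists x y : G, lower_central j x /\ z = [~ x, y])
  else fun _ => True.

Definition nilpotent_class_le (G : groupType) (c : nat) : Prop :=
  forall x : G, lower_central c x -> x = 1.

Definition nilpotent_group (G : groupType) : Prop :=
  exists c : nat, nilpotent_class_le G c.

Record automorphism (G : groupType) := Automorphism {
  aut_fun :> {multiplicative G -> G};
  aut_inv : G -> G;
  aut_funK : cancel aut_fun aut_inv;
  aut_invK : cancel aut_inv aut_fun
}.

Definition aut_expz (G : groupType) (f : automorphism G) (i : int) : G -> G :=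
  match i with Posz n => iter n f | Negz n => iter n.+1 (aut_inv f) end.

Definition satisfies_identity (G : groupType) (f : automorphism G)
    (k : nat) (m n : 'I_k -> int) : Prop :=
  forall x : G, 1 = \prod_(t < k) aut_expz f (m t) (expgz x (n t)).

Definition arithmetically_free (A : groupType) (X : A -> Prop) : Prop :=
  (exists s : seq A, forall x : A, X x -> x \in s) /\
  ~ (exists x y : A, [/\ X x, X y & forall i : int, X (x * expgz y i)]).

End Groups.

Definition identity_degree (k : nat) (m : 'I_k -> int) : nat :=
  \max_(s < k) \max_(t < k) `|m s - m t|%N.

Section MultiplicativeGroup.
Variable F : fieldType.
Local Open Scope ring_scope.

Record mulgroup := MulGroup { mulgroup_val :> F; _ : mulgroup_val != 0 }.

HB.instance Definition _ := [isSub for mulgroup_val].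
HB.instance Definition _ := [Choice of mulgroup by <:].

Implicit Types x y z : mulgroup.

Definition mulgroup_one : mulgroup := MulGroup (oner_neq0 F).

Lemma mulgroup_mul_subproof x y : val x * val y != 0.
Proof. by rewrite mulf_neq0 ?(valP x) ?(valP y). Qed.
Definition mulgroup_mul x y : mulgroup := MulGroup (mulgroup_mul_subproof x y).

Lemma mulgroup_inv_subproof x : (val x)^-1 != 0.
Proof. by rewrite invr_eq0 (valP x). Qed.
Definition mulgroup_inv x : mulgroup := MulGroup (mulgroup_inv_subproof x).

Lemma mulgroup_mulA : associative mulgroup_mul.
Proof. by move=> x y z; apply: val_inj; rewrite /= mulrA. Qed.

Lemma mulgroup_mul1g : left_id mulgroup_one mulgroup_mul.
Proof. by move=> x; apply: val_inj; rewrite /= mul1r. Qed.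

Lemma mulgroup_mulg1 : right_id mulgroup_one mulgroup_mul.
Proof. by move=> x; apply: val_inj; rewrite /= mulr1. Qed.

Lemma mulgroup_mulVg : left_inverse mulgroup_one mulgroup_inv mulgroup_mul.
Proof. by move=> x; apply: val_inj; rewrite /= mulVf ?(valP x). Qed.

Lemma mulgroup_mulgV : right_inverse mulgroup_one mulgroup_inv mulgroup_mul.
Proof. by move=> x; apply: val_inj; rewrite /= mulfV ?(valP x). Qed.

HB.instance Definition _ := isGroup.Build mulgroup mulgroup_mulA
  mulgroup_mul1g mulgroup_mulg1 mulgroup_mulVg mulgroup_mulgV.

End MultiplicativeGroup.

Section LaurentPolynomial.
Local Open Scope ring_scope.

(* Laurent polynomials over F are finitely supported families of coefficients *)
(* indexed by int: << c *g i >> stands for c z^i.                             *)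
Definition identity_laurent (F : fieldType) (k : nat) (m n : 'I_k -> int) :
    {malg F[int]} :=
  \sum_(t < k) << (n t)%:~R *g m t >>.

Definition laurent_root (F L : fieldType) (iota : {rmorphism F -> L})
    (r : {malg F[int]}) (z : mulgroup L) : Prop :=
  mmap iota (fun i : int => (z : L) ^ i) r = 0.

(* [iota] is meant to be the embedding of F into an algebraic closure L.      *)
Definition arithmetically_free_identity (F : fieldType) (L : closedFieldType)
    (iota : {rmorphism F -> L}) (k : nat) (m n : 'I_k -> int) : Prop :=
  arithmetically_free (laurent_root iota (identity_laurent F m n)).

(* [algC], the field of algebraic numbers, is an algebraic closure of Q.      *)
Definition arithmetically_free_over_rat (k : nat) (m n : 'I_k -> int) : Prop :=
  arithmetically_free_identity (@ratr algC : {rmorphism rat -> algC}) m n.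

End LaurentPolynomial.

(* Main.v *)
(* Let X be the set of nonzero roots of the polynomial of the identity, so that *)
(* #|X| <= d. The automorphism acts on the Lie algebra L obtained from the      *)
(* factors of the lower central series by extension of scalars to algC; it is   *)
(* annihilated by this polynomial, so its generalized eigenspaces grade L by    *)
(* the multiplicative group of the field with support in X.                     *)
(* Solvability: algC has a cyclic order on its multiplicative                   *)
(* group (by argument, then by modulus), and cutting it at 1 orders X so that   *)
(* a product of two weights never lies strictly between them. Kreknin's         *)
(* elimination then gives derived length at most 2 ^ #|X| - 1.                  *)
(* Nilpotency: if commuting letters of weights y_1, ..., y_r do not kill a      *)
(* vector of weight a, then a times any partial product of the y_i lies in X,   *)
(* and arithmetic freeness makes the set of these products grow with r; so      *)
(* r < #|X|, and every derived step costs a factor #|X| in the class.           *)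
(* Finally, if a factor of the lower central series vanishes after extension of *)
(* scalars then it is torsion, since its defining relations have integer        *)
(* coefficients; as G is nilpotent and torsion-free, the series stops there.    *)

(* The argument transfers a nilpotency bound from Lie algebras to groups. The sum L of the lower
   central factors, with scalars in [algC], is generated in degree 0, so [lie_gen_lcs] places its
   n-th factor in the n-th lower central term of L. On L the automorphism becomes the injective Lie
   endomorphism [lie_map], and products in the group become sums, so the identity becomes the
   polynomial relation [identity_poly_act]. Hence L is the sum of its generalized eigenspaces
   ([poly_act_prod0]); weights multiply under the bracket ([geig_br]) and lie in X ([geig_root],
   [geig0]).

   The heart is [graded_nilpotent], about brackets with weights in X. Its solvable half is
   [kreknin], fed by the ordering of [good_ordering_exists]; its nilpotent half is [lcs_derived],
   where [size_partial_weights] spends the arithmetic freeness. Together they kill every degree of L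
   from #|X| ^ (2 ^ #|X|) on. By [lie_gen_torsion] each element of such a term has a power in the
   next term, and [torsion_free_class] concludes. *)
Require Import Defs.
From HB Require Import structures.
From mathcomp Require Import all_boot all_order all_algebra all_field.
From mathcomp Require Import ring_quotient boolp finmap monalg ring.

Set Implicit Arguments.
Unset Strict Implicit.
Unset Printing Implicit Defensive.

Import Order.TTheory GRing.Theory Num.Theory.

Local Open Scope ring_scope.

(** * Graded Lie rings with arithmetically-free support *)

Section GradedFamilies.
Variables (K : fieldType) (L : zmodType) (br : L -> L -> L).
Hypothesis brDl : forall u v w, br (u + v) w = br u w + br v w.
Hypothesis brDr : forall u v w, br w (u + v) = br w u + br w v.
Hypothesis brC : forall u v, br u v = - br v u.
Hypothesis brJ : forall u v w, br u (br v w) = br (br u v) w - br (br u w) v.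

Lemma br0l u : br 0 u = 0.
Proof. by apply: (addrI (br 0 u)); rewrite -brDl !addr0. Qed.
Lemma br0r u : br u 0 = 0.
Proof. by rewrite brC br0l oppr0. Qed.
Lemma brNl u v : br (- u) v = - br u v.
Proof. by apply: (addIr (br u v)); rewrite -brDl !addNr br0l. Qed.
Lemma brNr u v : br u (- v) = - br u v.
Proof. by rewrite brC brNl -brC. Qed.
Lemma brBl u v w : br (u - v) w = br u w - br v w.
Proof. by rewrite brDl brNl. Qed.
Lemma brBr u v w : br w (u - v) = br w u - br w v.
Proof. by rewrite brDr brNr. Qed.
Lemma brJl u v w : br (br u v) w = br (br u w) v + br u (br v w).
Proof. by rewrite brJ addrC subrK. Qed.

(** A homogeneous subgroup is kept through its components, one predicate per weight. No independence
    of the components is asked, only that brackets multiply weights. *)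
Definition family := K -> L -> Prop.
Implicit Types (F H M N V : family) (X U : seq K).

Definition subfam F H := forall a u, F a u -> H a u.

Record additive_family F : Prop := AdditiveFamily {
  fam0 : forall a, F a 0;
  famB : forall a u v, F a u -> F a v -> F a (u - v) }.

Lemma famN F a u : additive_family F -> F a u -> F a (- u).
Proof. by move=> [F0 FB] Fu; rewrite -sub0r; apply: FB. Qed.
Lemma famD F a u v : additive_family F -> F a u -> F a v -> F a (u + v).
Proof. by move=> FF Fu Fv; rewrite -[v]opprK; apply: famB => //; apply: famN. Qed.

Inductive brspan F H : family :=
| brspan_br a b c u v : c = a * b -> F a u -> H b v -> brspan F H c (br u v)
| brspan0 c : brspan F H c 0
| brspanB c u v : brspan F H c u -> brspan F H c v -> brspan F H c (u - v).

Lemma brspan_add F H : additive_family (brspan F H).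
Proof. by split=> *; [apply: brspan0 | apply: brspanB]. Qed.
Hint Resolve brspan_add : core.

Lemma brspan_min F H N : additive_family N ->
  (forall a b u v, F a u -> H b v -> N (a * b) (br u v)) ->
  subfam (brspan F H) N.
Proof.
move=> addN NFH a u; elim=> [{}a b c {}u v -> Fu Hv|c|c {}u v _ Nu _ Nv].
- exact: NFH.
- exact: fam0.
- exact: famB.
Qed.

Lemma brspanS F F' H H' : subfam F F' -> subfam H H' ->
  subfam (brspan F H) (brspan F' H').
Proof.
move=> sF sH; apply: brspan_min => // a b u v /sF Fu /sH Hv.
exact: (brspan_br (erefl _) Fu Hv).
Qed.

Definition closed_under N V := forall a b u v, N a u -> V b v -> N (a * b) (br u v).

(** By Jacobi, bracketing with a fixed letter is a derivation. *)
Lemma closed_brspan M E V : additive_family M ->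
    closed_under M V -> closed_under E V -> closed_under (brspan M E) V.
Proof.
move=> addM MV EV a b u v Pu Vv; move: u Pu.
apply: (@brspan_min M E (fun a u => brspan M E (a * b) (br u v))).
  split=> [c|c u w]; rewrite ?br0l ?brBl; [exact: brspan0 | exact: brspanB].
move=> c e u w Mu Ew; rewrite brJl; apply: famD => //.
- by apply: (@brspan_br _ _ (c * b) e) => //; [rewrite mulrAC | apply: MV].
- by apply: (@brspan_br _ _ c (e * b)) => //; [rewrite mulrA | apply: EV].
Qed.

Record graded X V : Prop := Graded {
  graded_add : additive_family V;
  graded_br : closed_under V V;
  graded_supp : forall a u, V a u -> a \notin X -> u = 0 }.

Definition derived V := brspan V V.

Lemma derived_sub X V : graded X V -> subfam (derived V) V.
Proof. by case=> addV brV _; apply: brspan_min. Qed.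

Lemma derived_closed X V M : graded X V -> additive_family M ->
  closed_under M V -> closed_under (derived M) V.
Proof. by move=> gV addM MV; apply: closed_brspan. Qed.

Lemma derived_graded X V : graded X V -> graded X (derived V).
Proof.
move=> gV; have sDV := derived_sub gV; split.
- exact: brspan_add.
- move=> a b u v Du Dv; exact: (brspan_br (erefl _) (sDV _ _ Du) (sDV _ _ Dv)).
- by move=> a u /sDV Vu; apply: (graded_supp gV).
Qed.

Lemma iter_derived_graded X V n : graded X V -> graded X (iter n derived V).
Proof. by move=> gV; elim: n => //= n; apply: derived_graded. Qed.

Lemma iter_derived_sub X V n : graded X V -> subfam (iter n derived V) V.
Proof.
move=> gV; elim: n => //= n IHn a u /derived_sub Du.
by apply: IHn; apply: (Du X); apply: iter_derived_graded.
Qed.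

Lemma iter_derived_closed X V n : graded X V ->
  closed_under (iter n derived V) V.
Proof.
move=> gV; elim: n => [|n IHn] /=; first exact: graded_br gV.
by apply: (derived_closed gV) => //; apply: graded_add; apply: iter_derived_graded gV.
Qed.

(* The subalgebra generated by the components of weight in [U], as the span of *)
(* left-normed products.                                                       *)
Inductive gen V U : family :=
| gen_in a u : a \in U -> V a u -> gen V U a u
| gen_br a b c u v : c = a * b -> gen V U a u -> b \in U -> V b v ->
    gen V U c (br u v)
| gen0 c : gen V U c 0
| genB c u v : gen V U c u -> gen V U c v -> gen V U c (u - v).

Definition letters V U : family := fun a u => a \in U /\ V a u.

Lemma gen_add V U : additive_family (gen V U).
Proof. by split=> *; [apply: gen0 | apply: genB]. Qed.
Hint Resolve gen_add : core.

Lemma gen_min V U N : additive_family N -> subfam (letters V U) N ->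
  closed_under N (letters V U) -> subfam (gen V U) N.
Proof.
move=> addN VN NV a u; elim=> [{}a {}u Ua Va|{}a b c {}u v -> _ Nu Ub Vv|c|c {}u v _ Nu _ Nv].
- exact: VN.
- exact: NV.
- exact: fam0.
- exact: famB.
Qed.

(* Jacobi moves the last letter of the left-normed product [g] outwards. *)
Lemma br_gen V U M : additive_family M -> closed_under M (letters V U) ->
  forall b g, gen V U b g -> forall a u, M a u ->
    brspan M (letters V U) (a * b) (br u g).
Proof.
move=> addM MV.
apply: (@gen_min V U (fun b g => forall a u, M a u ->
  brspan M (letters V U) (a * b) (br u g))).
- split=> [b a u _|b g h Pg Ph a u Mu]; rewrite ?br0r ?brBr; first exact: brspan0.
  by apply: brspanB; [apply: Pg | apply: Ph].
- by move=> b v Vv a u Mu; apply: (brspan_br (erefl _) Mu).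
- move=> b c g v Pg Vv a u Mu; rewrite brJ; apply: brspanB; last first.
    by rewrite mulrA mulrAC; apply: Pg; apply: MV.
  apply: (@brspan_br _ _ (a * b) c) => //; rewrite ?mulrA //.
  by have := Pg _ _ Mu; apply: brspan_min.
Qed.

Lemma gen_closed V U : closed_under (gen V U) (gen V U).
Proof.
have GV: closed_under (gen V U) (letters V U).
  by move=> c d w z Gw [Ud Vz]; apply: (gen_br (erefl _)).
by move=> a b u v Gu Gv; have := br_gen (@gen_add V U) GV Gv Gu; apply: brspan_min.
Qed.

Lemma gen_mono V V' U U' : subfam (letters V U) (gen V' U') ->
  subfam (gen V U) (gen V' U').
Proof.
move=> sVG; apply: gen_min => // a b u v Gu Vv.
by apply: gen_closed => //; apply: sVG.
Qed.

Lemma gen_nil V a u : gen V [::] a u -> u = 0.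
Proof.
apply: (@gen_min V [::] (fun _ u => u = 0)); last by move=> ? ? ? ? _ [].
  by split=> // ? u' v -> ->; rewrite subrr.
by move=> ? ? [].
Qed.

(* When [x] is eliminated after [s1], it must not be the product of an already *)
(* eliminated weight and a remaining one.                                      *)
Definition good_ordering X := forall s1 x s2 a c,
  X = s1 ++ x :: s2 -> a \in s1 -> c \in s2 -> a * c != x.

(* Kreknin's elimination: dropping one more weight from the generators doubles *)
(* the depth in the derived series.                                            *)
Lemma kreknin X s1 s2 V : 0 \notin X -> 1 \notin X -> good_ordering X ->
    graded X V -> X = s1 ++ s2 ->
  subfam (iter (2 ^ size s1 - 1) derived V) (gen V s2).
Proof.
move=> X0 X1 ordX; elim/last_ind: s1 s2 V => [|s1 x IHs] s2 V gV defX.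
  move=> a u Vu; have [Xa|/(graded_supp gV Vu)->] := boolP (a \in X).
    by apply: gen_in => //; rewrite defX in Xa.
  exact: gen0.
rewrite cat_rcons in defX.
pose n := (2 ^ size s1 - 1)%N.
(* Room for n derived steps down to [W], one more that deals with the weight x, and n again. *)
have n1 : (2 ^ size (rcons s1 x) - 1 = n + (1 + n))%N.
  rewrite size_rcons expnS /n; have : (0 < 2 ^ size s1)%N by rewrite expn_gt0.
  by case: (2 ^ size s1)%N => // k _; rewrite mul2n -addnn !subn1 /= add1n addnS.
rewrite n1 iterD iterD /=; set W := iter n derived V.
have gW : graded X W by apply: iter_derived_graded.
have sWV : subfam W V by apply: iter_derived_sub gV.
have sDV : subfam (derived W) V by move=> a u /(derived_sub gW)/sWV.
have Xx : x \in X by rewrite defX mem_cat in_cons eqxx orbT.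
(* By induction the second factor is a sum of products of letters of weights in [x :: s2], and
   [br_gen] reduces to brackets with a letter of weight c, where a * c = x. As 1 is not in X,
   neither a nor c is x; the ordering keeps a out of [s1]. So a and c both lie in [s2]. *)
have Dx u : derived W x u -> gen V s2 x u.
  move=> Du; pose N y v := y = x -> gen V s2 x v.
  have addN : additive_family N.
    split=> [y _|y v w Gv Gw /[dup] /Gv ? /Gw ?]; [exact: gen0|exact: genB].
  suff : N x u by apply.
  move: u Du; apply: (@brspan_min W W) => // a b v w Wv Ww _ab.
  have addV := graded_add gV.
  have VV : closed_under V (letters V (x :: s2)).
    by move=> c d y1 y2 Vy1 [_ Vy2]; apply: (graded_br gV).
  have := br_gen addV VV (IHs (x :: s2) V gV defX _ _ Ww) (sWV _ _ Wv).
  rewrite _ab; move=> Bvw; suff : N x (br v w) by apply.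
  move: (br v w) Bvw => {v w Wv Ww}; apply: (@brspan_min V (letters V (x :: s2)) N) => //.
  move=> {a b _ab} a c y z Vy [Uc Vz] ac.
  have [Xa|/(graded_supp gV Vy)->] := boolP (a \in X); last first.
    by rewrite br0l; apply: gen0.
  have x0 : x != 0 by apply: contraNneq X0 => <-.
  have neq1 t : t * x = x -> t = 1.
    by move=> tx; apply: (mulIf x0); rewrite mul1r.
  have s2c : c \in s2.
    move: Uc; rewrite in_cons => /predU1P[cx|//]; move: X1.
    by rewrite cx in ac; rewrite -(neq1 _ ac) Xa.
  have ax : a != x.
    apply: contraNneq X1 => ax; rewrite ax mulrC in ac.
    by rewrite -(neq1 _ ac) defX mem_cat in_cons s2c !orbT.
  have s2a : a \in s2.
    move: Xa; rewrite defX mem_cat in_cons (negPf ax) /= => /orP[s1a|//].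
    by have := ordX _ _ _ _ _ defX s1a s2c; rewrite ac eqxx.
  by rewrite -ac; apply: (gen_br (erefl _)) => //; apply: gen_in.
(* After n further derived steps everything is generated by letters of [derived W]; those of weight
   x are rewritten by [Dx]. *)
have := IHs (x :: s2) (derived W) (derived_graded gW) defX.
move=> sDG a u /sDG; apply: gen_mono => // b v [].
rewrite in_cons => /predU1P[->|s2b] Db; first exact: Dx.
by apply: gen_in => //; apply: sDV.
Qed.

Lemma kreknin_solvable X V : 0 \notin X -> 1 \notin X -> good_ordering X ->
  graded X V -> forall a u, iter (2 ^ size X - 1) derived V a u -> u = 0.
Proof.
move=> X0 X1 ordX gV a u Du.
by apply: (@gen_nil V a); apply: (kreknin X0 X1 ordX gV) Du; rewrite cats0.
Qed.

Fixpoint lcs M V n : family := if n is n'.+1 then brspan (lcs M V n') V else M.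

Lemma lcsS M M' V n : subfam M M' -> subfam (lcs M V n) (lcs M' V n).
Proof. by move=> sM; elim: n => //= n IHn; apply: brspanS. Qed.

Lemma lcsD M V m n : lcs M V (m + n) = lcs (lcs M V m) V n.
Proof. by elim: n => [|n IHn]; rewrite ?addn0 // addnS /= IHn. Qed.

Record ideal V M : Prop := Ideal {
  ideal_add : additive_family M;
  ideal_closed : closed_under M V;
  ideal_sub : subfam M V }.

Lemma ideal_derived X V n : graded X V -> ideal V (iter n derived V).
Proof.
move=> gV; split; first exact: graded_add (iter_derived_graded n gV).
- exact: iter_derived_closed gV.
- exact: iter_derived_sub gV.
Qed.

Lemma ideal_brspan X V M E : graded X V -> ideal V M -> ideal V E ->
  ideal V (brspan M E).
Proof.
move=> gV [addM MV sMV] [addE EV sEV]; split; first exact: brspan_add.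
- exact: closed_brspan.
- apply: brspan_min; first exact: graded_add gV.
  by move=> a b u v /sMV Vu /sEV Vv; apply: (graded_br gV).
Qed.

Definition brs (m : L) (es : seq (K * L)) := foldl (fun u e => br u e.2) m es.

Fixpoint partial_weights (a : K) (ys : seq K) : seq K :=
  if ys is y :: ys' then partial_weights a ys' ++ partial_weights (a * y) ys'
  else [:: a].

Lemma brsB m m' es : brs (m - m') es = brs m es - brs m' es.
Proof. by elim: es m m' => //= e es IHes m m'; rewrite brBl IHes. Qed.
Lemma brsD m m' es : brs (m + m') es = brs m es + brs m' es.
Proof. by elim: es m m' => //= e es IHes m m'; rewrite brDl IHes. Qed.
Lemma brs0 es : brs 0 es = 0.
Proof. by elim: es => //= e es IHes; rewrite br0l. Qed.

Definition homogeneous E (es : seq (K * L)) := forall e, e \in es -> E e.1 e.2.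

Section CommutingLetters.
Variables (X : seq K) (V M E : family).
Hypotheses (gV : graded X V) (idM : ideal V M) (idE : ideal V E).
(** By Jacobi, letters from [E] act on [M] by commuting maps modulo this ideal [M, [E, E]]. *)
Let N := brspan M (derived E).

Let idN : ideal V N.
Proof.
apply: (ideal_brspan gV) => //; split; first exact: brspan_add.
- by apply: closed_brspan; case: idE.
- apply: brspan_min; first exact: graded_add gV.
  by case: idE => _ EV sEV a b u v Eu /sEV Vv; apply: sEV; apply: EV.
Qed.

Let ME a b m e : M a m -> E b e -> M (a * b) (br m e).
Proof. by move=> Mm Ee; apply: (ideal_closed idM) => //; apply: (ideal_sub idE). Qed.

Let N_brs a u es : N a u -> homogeneous E es -> N (foldl *%R a (map fst es)) (brs u es).
Proof.
elim: es a u => //= e es IHes a u Nu Ees; apply: IHes.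
  apply: (ideal_closed idN) => //; apply: (ideal_sub idE).
  by apply: Ees; rewrite mem_head.
by move=> f es_f; apply: Ees; rewrite in_cons es_f orbT.
Qed.

(** Moving [e] past a neighbour [f] costs [br m (br e f)], an element of [N]; since [N] is an ideal,
    the remaining letters keep the error there. *)
Lemma brs_swap a m b e es : M a m -> E b e -> homogeneous E es ->
  N (foldl *%R (a * b) (map fst es)) (brs (br m e) es - br (brs m es) e).
Proof.
elim: es a m => [|[c f] es IHes] a m Mm Ee Ees /=.
  by rewrite subrr; apply: brspan0.
have Ecf: E c f by apply: (Ees (c, f)); rewrite mem_head.
have Ees' : homogeneous E es by move=> g es_g; apply: Ees; rewrite in_cons es_g orbT.
have -> : brs (br (br m e) f) es - br (brs (br m f) es) e =
   brs (br m (br e f)) es + (brs (br (br m f) e) es - br (brs (br m f) es) e).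
  rewrite addrA; congr (_ - _).
  by rewrite -brsD brJl addrC.
apply: famD; first exact: (ideal_add idN).
  rewrite -mulrA; apply: N_brs => //; apply: (brspan_br (erefl _)) => //.
  exact: (brspan_br (erefl _)).
by rewrite mulrAC; apply: IHes => //; apply: ME.
Qed.

(* Modulo [N] the letters commute, so any subset of them can act first. *)
Lemma brs_partial a m es : M a m -> homogeneous E es ->
  N (foldl *%R a (map fst es)) (brs m es) \/
  {subset partial_weights a (map fst es) <= X}.
Proof.
elim: es a m => [|[c f] es IHes] a m Mm Ees /=.
  have [Xa|/(graded_supp gV (ideal_sub idM Mm)) ->] := boolP (a \in X); last first.
    by left; apply: brspan0.
  by right=> z; rewrite inE => /eqP->.
have Ecf: E c f by apply: (Ees (c, f)); rewrite mem_head.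
have Ees' : homogeneous E es by move=> g es_g; apply: Ees; rewrite in_cons es_g orbT.
have [|sX1] := IHes _ _ (ME Mm Ecf) Ees'; first by left.
have [Nm|sX2] := IHes _ _ Mm Ees'; last first.
  by right=> z; rewrite mem_cat => /orP[/sX2|/sX1].
(* Here [es] already sends [m] into the ideal [N], so [f] is made to act last, at the cost of
   [brs_swap]. *)
left; rewrite -[brs _ _](subrK (br (brs m es) f)).
apply: famD; [exact: (ideal_add idN)| exact: brs_swap |].
suff -> : foldl *%R (a * c) (map fst es) = foldl *%R a (map fst es) * c.
  by apply: (ideal_closed idN) => //; apply: (ideal_sub idE).
by elim: (map fst es) a {Mm IHes sX1 Nm} => //= y ys IHys a; rewrite mulrAC IHys.
Qed.

Hypotheses (X0 : 0 \notin X).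
Hypothesis Xfree : forall a y, a \in X -> y \in X -> ~ (forall n, a * y ^+ n \in X).

Lemma partial_weightsM a y ys :
  partial_weights (a * y) ys = map ( *%R^~ y) (partial_weights a ys).
Proof. by elim: ys a => //= z ys IHys a; rewrite map_cat -!IHys mulrAC. Qed.

Lemma mem_partial_weights a ys : a \in partial_weights a ys.
Proof. by elim: ys a => [|y ys IHys] a /=; rewrite ?mem_head // mem_cat IHys. Qed.

(* The set of partial products grows with each new letter [y]: were it stable  *)
(* under [y], it would contain all [a * y ^+ n].                               *)
Lemma size_partial_weights a ys : {subset ys <= X} ->
  {subset partial_weights a ys <= X} ->
  (size ys < size (undup (partial_weights a ys)))%N.
Proof.
elim: ys => [|y ys IHys] //= sysX swX.
have sw1 : {subset partial_weights a ys <= X}.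
  by move=> z wz; apply: swX; rewrite mem_cat wz.
have Xy : y \in X by apply: sysX; rewrite mem_head.
have {}IHys : (size ys < size (undup (partial_weights a ys)))%N.
  by apply: IHys => // z ys_z; apply: sysX; rewrite in_cons ys_z orbT.
have [/allP wy|/allPn[z wyz wNz]] :=
    boolP (all (mem (partial_weights a ys)) (partial_weights (a * y) ys)).
  case: (Xfree (sw1 _ (mem_partial_weights a ys)) Xy) => n; apply: sw1.
  elim: n => [|n IHn]; first by rewrite mulr1 mem_partial_weights.
  by apply: wy; rewrite partial_weightsM exprSr mulrA; apply: map_f.
apply: leq_ltn_trans IHys _; apply: (@leq_trans (size (z :: undup (partial_weights a ys)))) => //.
apply: uniq_leq_size; first by rewrite /= undup_uniq mem_undup andbT.
move=> t; rewrite in_cons !mem_undup mem_cat => /predU1P[->|->] //.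
by rewrite wyz orbT.
Qed.

(** Otherwise all partial weights lie in X. If the letters also have weights in X,
    [size_partial_weights] finds more than #|X| distinct elements of X; a letter of weight outside X
    is 0 and kills the product. *)
Lemma brs_size a m es : M a m -> homogeneous E es -> size es = size X ->
  N (foldl *%R a (map fst es)) (brs m es).
Proof.
move=> Mm Ees szX; have [//|sX] := brs_partial Mm Ees.
have [/allP sysX|/allPn[_ /mapP[[b e] es_b ->] XNb]] := boolP (all (mem X) (map fst es)).
  have := size_partial_weights sysX sX; rewrite size_map szX ltnNge.
  rewrite uniq_leq_size ?undup_uniq // => z; rewrite mem_undup; exact: sX.
have e0 : e = 0 := graded_supp gV (ideal_sub idE (Ees _ es_b)) XNb.
move: es_b; rewrite e0 => es_b {sX szX Ees}.
suff -> : brs m es = 0 by apply: brspan0.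
elim: es m es_b {Mm} => //= f es IHes m; rewrite in_cons => /predU1P[<-|es_b].
  by rewrite br0r brs0.
exact: IHes.
Qed.

Lemma iter_brspan_sub : subfam (iter (size X) (brspan^~ E) M) N.
Proof.
(* The base family varies in the induction, each bracket with [E] moving from the family into the
   list of letters. *)
have := brs_size; move: (size X) => n; move: M => M' HM.
have: forall a m es, M' a m -> homogeneous E es -> size es = n ->
  N (foldl *%R a (map fst es)) (brs m es) by [].
elim: n M' {HM} => [|n IHn] M' HM.
  by move=> a m M'm; apply: (HM a m [::]).
rewrite iterSr; apply: IHn => a m es Mm Ees szn; move: m Mm.
apply: (@brspan_min M' E (fun a m => N (foldl *%R a (map fst es)) (brs m es))).
  by split=> [b|b u v Nu Nv]; rewrite ?brs0 ?brsB; [apply: brspan0|apply: brspanB].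
move=> b c u v M'u Ev; apply: (HM b u ((c, v) :: es)) => //=; last by rewrite szn.
by move=> f; rewrite in_cons => /predU1P[->|/Ees].
Qed.

End CommutingLetters.

(** With E the n-th derived term, #|X| ^ n brackets with V amount to one bracket with E. Hence #|X|
    such blocks give #|X| brackets with E, which [iter_brspan_sub] turns into one bracket with
    [E, E]. *)
Lemma lcs_derived X V n M : 0 \notin X ->
    (forall a y, a \in X -> y \in X -> ~ (forall n, a * y ^+ n \in X)) ->
    graded X V -> ideal V M ->
  subfam (lcs M V (size X ^ n)) (brspan M (iter n derived V)).
Proof.
move=> X0 Xfree gV; elim: n M => [|n IHn] M idM //=; rewrite expnS.
have idE := ideal_derived n gV; set E := iter n derived V in IHn idE *.
suff lcsM k : subfam (lcs M V (k * size X ^ n)) (iter k (brspan^~ E) M).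
  by move=> a u /lcsM; apply: (iter_brspan_sub gV).
have idk k' : ideal V (iter k' (brspan^~ E) M).
  by elim: k' => //= k' IHk; apply: (ideal_brspan gV).
elim: k => [|k IHk]; first by [].
rewrite mulSnr lcsD => a u /(lcsS IHk); exact: IHn.
Qed.

Theorem graded_nilpotent X V : 0 \notin X -> 1 \notin X -> good_ordering X ->
    (forall a y, a \in X -> y \in X -> ~ (forall n, a * y ^+ n \in X)) ->
    graded X V ->
  forall a u, lcs V V (size X ^ (2 ^ size X)) a u -> u = 0.
Proof.
move=> X0 X1 ordX Xfree gV a u.
have idV : ideal V V by apply: (ideal_derived 0 gV).
move/(lcs_derived X0 Xfree gV idV); apply: (@brspan_min V _ (fun _ u => u = 0)).
  by split=> // b v w -> ->; rewrite subrr.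
(* The exponent exceeds the bound of [kreknin_solvable] by one; the extra derived step stays inside
   a vanishing term. *)
have -> : (2 ^ size X = 1 + (2 ^ size X - 1))%N by rewrite subnKC // expn_gt0.
rewrite iterD /= => b c v w _ Dw.
suff -> : w = 0 by rewrite br0r.
by apply: (kreknin_solvable X0 X1 ordX gV); apply: (derived_sub (iter_derived_graded _ gV)) Dw.
Qed.

End GradedFamilies.

(** * The cyclic order on the multiplicative group *)

Section CyclicOrder.
Variable C : numClosedFieldType.
Implicit Types z w : C.

(* [cotan (t / 2)] for [z = `|z| * exp (i t)]: a decreasing real parameter of  *)
(* the circle cut at [1].                                                      *)
Definition half_cotan z : C := 'i * (z + `|z|) / (z - `|z|).

(** Conjugation fixes the quotient because z times its conjugate is the square of the modulus. *)
Lemma half_cotan_real z : half_cotan z \is Num.real.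
Proof.
apply/CrealP; rewrite /half_cotan !rmorphM /= fmorphV /= rmorphD rmorphB /=.
have [->|z0] := eqVneq z 0; first by rewrite conjC0 !normr0 conjC0 addr0 !mulr0 !mul0r.
have rR : `|z|^* = `|z| by apply/CrealP; rewrite realE normr_ge0.
rewrite rR conjCi; have zz : z * z^* = `|z| * `|z| by rewrite -normCK expr2.
(* On positive reals the denominator is 0, and the convention for its inverse gives the value 0. *)
have [zr|zr] := eqVneq (z - `|z|) 0.
  have zrc : z^* - `|z| = 0 by rewrite -rR -rmorphB zr rmorph0.
  by rewrite zr zrc invr0 !mulr0.
have zrc : z^* - `|z| != 0 by rewrite -rR -rmorphB conjC_eq0.
apply/eqP; rewrite eqr_div // -subr_eq0; apply/eqP.
have -> : - 'i * (z^* + `|z|) * (z - `|z|) - 'i * (z + `|z|) * (z^* - `|z|) =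
  2 * 'i * (`|z| * `|z| - z * z^*) by ring.
by rewrite zz subrr mulr0.
Qed.

(** The addition formula of the cotangent, in product form because the sum of the two cotangents may
    vanish. *)
Lemma half_cotanM z w : z != `|z| -> w != `|w| -> z * w != `|z * w| ->
  half_cotan (z * w) * (half_cotan z + half_cotan w) =
  half_cotan z * half_cotan w - 1.
Proof.
rewrite /half_cotan normrM; move: `|z| `|w| => r s.
rewrite -(subr_eq0 z) -(subr_eq0 w) -(subr_eq0 (z * w)) => zr ws zwrs.
have ii : 'i * 'i = -1 :> C by rewrite -expr2 sqrCi.
have -> : 'i * (z + r) / (z - r) + 'i * (w + s) / (w - s) =
    'i * (2 * (z * w - r * s)) / ((z - r) * (w - s)) by field; rewrite zr ws.
have -> : 'i * (z + r) / (z - r) * ('i * (w + s) / (w - s)) =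
   ('i * 'i) * ((z + r) * (w + s) / ((z - r) * (w - s))) by field; rewrite zr ws.
have -> : 'i * (z * w + r * s) / (z * w - r * s) *
  ('i * (2 * (z * w - r * s)) / ((z - r) * (w - s))) =
  ('i * 'i) * (2 * (z * w + r * s) / ((z - r) * (w - s))).
  by field; rewrite zr ws zwrs.
by rewrite ii; field; rewrite zr ws.
Qed.

(* The positive reals are the fibre of the cut, split by their modulus between *)
(* both ends.                                                                  *)
Definition cut_rank z : nat := if 0 < z then (if 1 < z then 0 else 2) else 1.

(** One turn starting after 1: the reals above 1 increasing, then arguments increasing from 0 to 2
    pi (so [half_cotan] decreasing) with ties broken by modulus, finally the positive reals up to
    1. *)
Definition cut_le z w :=
  (cut_rank z < cut_rank w)%N || (cut_rank z == cut_rank w) &&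
  (if cut_rank z == 1%N then
     (half_cotan w < half_cotan z) ||
     (half_cotan w == half_cotan z) && (`|z| <= `|w|)
   else z <= w).

Lemma cut_rank1 z : (cut_rank z == 1%N) = ~~ (0 < z).
Proof. by rewrite /cut_rank; case: ifP => //; case: ifP. Qed.

Lemma cut_le_total : total cut_le.
Proof.
move=> z w; rewrite /cut_le [cut_rank w == _]eq_sym.
case: (ltngtP (cut_rank z) (cut_rank w)) => //= eqr.
rewrite -eqr; have [_|z1] := ifP.
  have [] := real_ltgtP (half_cotan_real z) (half_cotan_real w); rewrite ?orbT //= => _.
  by apply: real_leVge; apply: normr_real.
have w1 := z1; rewrite eqr in w1; move: z1 w1; rewrite !cut_rank1 => /negbFE z0 /negbFE w0.
by apply: real_leVge; apply: gtr0_real.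
Qed.

Lemma cut_le_trans : transitive cut_le.
Proof.
move=> y x z; rewrite /cut_le.
case/orP=> [xy|/andP[/eqP <- xy]]; case/orP=> [yz|/andP[/eqP yz {}yz']].
- by rewrite (ltn_trans xy yz).
- by rewrite -yz xy.
- by rewrite yz.
rewrite -yz eqxx ltnn /=; move: xy yz'; case: ifP => _; last exact: le_trans.
case/orP=> [xy|/andP[/eqP xy xyn]]; case/orP=> [yz'|/andP[/eqP yz' yzn]].
- by rewrite (lt_trans yz' xy).
- by rewrite yz' xy.
- by rewrite -xy yz'.
- by rewrite yz' xy eqxx (le_trans xyn yzn) !orbT.
Qed.

Lemma norm_eq_pos z : z != 0 -> (z == `|z|) = (0 < z).
Proof.
move=> z0; apply/eqP/idP => [->|/gtr0_norm//]; by rewrite normr_gt0.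
Qed.

Lemma half_cotan_pos z w : 0 < w -> half_cotan (w * z) = half_cotan z.
Proof.
move=> w0; rewrite /half_cotan normrM (gtr0_norm w0) -mulrDr -mulrBr.
by rewrite mulrCA -mulf_div divff ?mul1r ?gt_eqF.
Qed.

(** Two arguments strictly between 0 and 2 pi add up, modulo 2 pi, to something above both or below
    both. If a factor is a positive real, the product lies on the ray of the other one and the
    moduli decide. *)
Lemma cut_le_between a c : a != 0 -> c != 0 -> a != 1 -> c != 1 ->
  cut_le a (a * c) -> cut_le (a * c) c -> False.
Proof.
move=> a0 c0 a1 c1; rewrite /cut_le /cut_rank.
have pos_cmp z : 0 < z -> z != 1 -> (1 < z) || (z < 1).
  by move=> z0 z1; rewrite orbC -real_neqr_lt ?gtr0_real ?real1.
have [apos|aNpos] := boolP (0 < a); have [cpos|cNpos] := boolP (0 < c).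
- rewrite mulr_gt0 //; have [a_gt1|aNgt1] := boolP (1 < a).
    have cac : c < a * c by rewrite ltr_pMl.
    case: ifP => //= ac_gt1; case: ifP => //= c_gt1; rewrite ?(lt_geF cac) //.
    by have := pos_cmp c cpos c1; rewrite c_gt1 /= => c_lt1; rewrite ler_pMr // lt_geF.
  case: ifP => //= ac_gt1; rewrite ler_pMr // => c_ge1.
  by rewrite lt_def c1 c_ge1.
- rewrite pmulr_rgt0 // (negPf cNpos) /= half_cotan_pos // ltxx eqxx /=.
  rewrite normrM (gtr0_norm apos) ger_pMl ?normr_gt0 // => + a_le1.
  by rewrite (le_gtF a_le1).
- rewrite pmulr_lgt0 // (negPf aNpos) /= mulrC half_cotan_pos // ltxx eqxx /=.
  rewrite normrM (gtr0_norm cpos) ler_pMl ?normr_gt0 // => c_ge1.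
  by rewrite lt_def c1 c_ge1.
have [acpos|acNpos] := boolP (0 < a * c); first by case: ifP.
rewrite /= => le1 le2; have ac0 : a * c != 0 by rewrite mulf_neq0.
have := half_cotanM _ _ _; move=> /(_ a c).
rewrite !norm_eq_pos // => /(_ aNpos cNpos acNpos).
have {le1} : half_cotan (a * c) <= half_cotan a.
  by case/orP: le1 => [/ltW//|/andP[/eqP->]].
have {le2} : half_cotan c <= half_cotan (a * c).
  by case/orP: le2 => [/ltW//|/andP[/eqP->]].
move: (half_cotan_real a) (half_cotan_real c) (half_cotan_real (a * c)).
move: (half_cotan a) (half_cotan c) (half_cotan (a * c)) => x y t xR yR tR yt tx.
have pos z : z \is Num.real -> 1 + z ^+ 2 != 0.
  by move=> zR; rewrite gt_eqF // ltr_pwDl // real_exprn_even_ge0.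
(* Now y <= t <= x and t * (x + y) = x * y - 1. Bounding t by x or by y, according to the sign of x
   + y, gives 1 + x ^+ 2 <= 0 or 1 + y ^+ 2 <= 0; a zero sum gives 1 + x ^+ 2 = 0. *)
have [xy0|xy0|xy0] := real_ltgtP (rpredD xR yR) (real0 _) => txy.
- have : x * (x + y) <= t * (x + y) by rewrite ler_wnM2r // ltW.
  rewrite txy mulrDr -subr_ge0.
  have -> : x * y - 1 - (x * x + x * y) = - (1 + x ^+ 2) by ring.
  by rewrite oppr_ge0 lt_geF // ltr_pwDl // real_exprn_even_ge0.
- have : y * (x + y) <= t * (x + y) by rewrite ler_wpM2r // ltW.
  rewrite txy mulrDr -subr_ge0.
  have -> : x * y - 1 - (y * x + y * y) = - (1 + y ^+ 2) by ring.
  by rewrite oppr_ge0 lt_geF // ltr_pwDl // real_exprn_even_ge0.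
move: txy; rewrite xy0 mulr0; have /eqP := xy0; rewrite addrC addr_eq0 => /eqP ->.
move=> /eqP; rewrite eq_sym -oppr_eq0.
have -> : - (x * - x - 1) = 1 + x ^+ 2 by ring.
by rewrite (negPf (pos _ xR)).
Qed.

(** After sorting by [cut_le], a product a * c = x would lie between the earlier a and the later
    c. *)
Lemma good_ordering_exists (X : seq C) : 0 \notin X -> 1 \notin X ->
  exists2 Y, perm_eq X Y & good_ordering Y.
Proof.
move=> X0 X1; exists (sort cut_le X); first by rewrite perm_sym perm_sort.
move=> s1 x s2 a c defX s1a s2c; apply/eqP => acx.
have := sort_sorted cut_le_total X; rewrite defX (sorted_pairwise cut_le_trans).
rewrite pairwise_cat /= => /and3P[/allrelP le1 _ /andP[/allP le2 _]].
have memX z : z \in s1 ++ x :: s2 -> z \in X by rewrite -defX mem_sort.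
have Xa : a \in X by apply: memX; rewrite mem_cat s1a.
have Xc : c \in X by apply: memX; rewrite mem_cat in_cons s2c !orbT.
apply: (@cut_le_between a c); rewrite ?acx; try by apply: contraNneq X0 => <-.
- by apply: contraNneq X1 => <-.
- by apply: contraNneq X1 => <-.
- by apply: le1; rewrite ?mem_head.
- exact: le2.
Qed.

End CyclicOrder.

(** * Modules given by generators and relations *)

Section PresentedModule.
Variables (F : fieldType) (K : choiceType) (R : {malg F[K]} -> Prop).

Inductive relation_span : {malg F[K]} -> Prop :=
| relation_span0 : relation_span 0
| relation_spanD c r v : R r -> relation_span v -> relation_span (c *: r + v).

Lemma relation_spanZ a v : relation_span v -> relation_span (a *: v).
Proof.
elim=> [|c r {}v Rr _ Rv]; first by rewrite scaler0; apply: relation_span0.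
by rewrite scalerDr scalerA; apply: relation_spanD.
Qed.

Lemma relation_span_add u v : relation_span u -> relation_span v ->
  relation_span (u + v).
Proof.
by elim=> [|c r {}u Rr _ IHu] Sv; rewrite ?add0r // -addrA; apply/relation_spanD/IHu.
Qed.

Definition relation_pred : {pred {malg F[K]}} := fun v => `[< relation_span v >].

Lemma relation_zmod_closed : zmod_closed relation_pred.
Proof.
split=> [|u v /asboolP Su /asboolP Sv]; apply/asboolP; first exact: relation_span0.
by apply: relation_span_add => //; rewrite -scaleN1r; apply: relation_spanZ.
Qed.
HB.instance Definition _ :=
  GRing.isZmodClosed.Build {malg F[K]} relation_pred relation_zmod_closed.

Definition presented : Type := Quotient.quot relation_pred.
HB.instance Definition _ := GRing.Zmodule.on presented.

Definition presented_pi (v : {malg F[K]}) : presented :=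
  \pi_(Quotient.quot relation_pred)%qT v.
Definition presented_repr (v : presented) : {malg F[K]} := 
  repr (v : Quotient.quot relation_pred).

Lemma presented_piD u v : presented_pi (u + v) = presented_pi u + presented_pi v.
Proof. exact: raddfD. Qed.
Lemma presented_pi_eq u v : presented_pi u = presented_pi v <-> relation_span (u - v).
Proof.
rewrite /presented_pi; split=> [/eqP|Suv].
  by rewrite -Quotient.idealrBE => /asboolP.
by apply/eqP; rewrite -Quotient.idealrBE; apply/asboolP.
Qed.
Lemma presented_reprK v : presented_pi (presented_repr v) = v.
Proof. exact: reprK. Qed.

Definition presented_scale a v := presented_pi (a *: presented_repr v).

Lemma presented_piZ a v : presented_pi (a *: v) = presented_scale a (presented_pi v).
Proof.
apply/presented_pi_eq; rewrite -scalerBr; apply: relation_spanZ.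
by apply/presented_pi_eq; rewrite presented_reprK.
Qed.

Lemma presented_scaleA a b v :
  presented_scale a (presented_scale b v) = presented_scale (a * b) v.
Proof. by rewrite -[v]presented_reprK -!presented_piZ scalerA. Qed.
Lemma presented_scale1 : left_id 1 presented_scale.
Proof. by move=> v; rewrite -[v]presented_reprK -!presented_piZ scale1r. Qed.
Lemma presented_scaleDr : right_distributive presented_scale +%R.
Proof.
move=> a u v; rewrite -[u]presented_reprK -[v]presented_reprK.
by rewrite -presented_piD -!presented_piZ scalerDr presented_piD.
Qed.
Lemma presented_scaleDl v : {morph presented_scale^~ v : a b / a + b}.
Proof.
by move=> a b; rewrite -[v]presented_reprK -!presented_piZ scalerDl presented_piD.
Qed.
HB.instance Definition _ := GRing.Zmodule_isLmodule.Build F presented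
  presented_scaleA presented_scale1 presented_scaleDr presented_scaleDl.

Lemma presented_pi_linear : linear presented_pi.
Proof. by move=> a u v; rewrite presented_piD presented_piZ. Qed.
End PresentedModule.

(** The quotient is remembered only through a surjection and its kernel, from which its universal
    property [pres_lift] follows. *)
Record presentation (F : fieldType) (K : choiceType) (R : {malg F[K]} -> Prop) :=
  Presentation {
  pres_mod :> lmodType F;
  pres_pi : {linear {malg F[K]} -> pres_mod};
  pres_surj : forall v, exists m, pres_pi m = v;
  pres_ker : forall m, pres_pi m = 0 <-> relation_span R m }.

Lemma presentation_exists (F : fieldType) (K : choiceType) (R : {malg F[K]} -> Prop) :
  inhabited (presentation R).
Proof.
pose piL := GRing.isLinear.Build F {malg F[K]} (presented R) _ (presented_pi R)
  (@presented_pi_linear F K R).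
pose pi : {linear {malg F[K]} -> presented R} := HB.pack (presented_pi R) piL.
constructor; exists (presented R) pi => [v|m].
  by exists (presented_repr v); apply: presented_reprK.
rewrite -[m in X in _ <-> X]subr0 -presented_pi_eq.
suff -> : presented_pi R 0 = 0 by [].
exact: (linear0 pi).
Qed.

Section MalgLift.
Variables (F : fieldType) (K : choiceType).
Variables (V : lmodType F) (g : K -> V).

Definition malg_lift (v : {malg F[K]}) : V := \sum_(k <- msupp v) v@_k *: g k.

Lemma malg_liftE (d : {fset K}) v : (msupp v `<=` d)%fset ->
  malg_lift v = \sum_(k <- d) v@_k *: g k.
Proof.
move=> vd; rewrite /malg_lift (big_fset_incl _ vd) // => k _ kNv.
by rewrite mcoeff_outdom ?scale0r.
Qed.

Lemma malg_lift_linear : linear malg_lift.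
Proof.
move=> a u v; pose d := (msupp u `|` msupp v)%fset.
have du : (msupp u `<=` d)%fset by apply: fsubsetUl.
have dv : (msupp v `<=` d)%fset by apply: fsubsetUr.
have dw : (msupp (a *: u + v) `<=` d)%fset.
  apply: fsubset_trans (msuppD_le _ _) _; rewrite fsubUset dv andbT.
  exact: fsubset_trans (msuppZ_le _ _) du.
rewrite !(@malg_liftE d) // scaler_sumr -big_split /=; apply: eq_bigr => k _.
by rewrite mcoeffD mcoeffZ scalerDl scalerA.
Qed.
HB.instance Definition _ :=
  GRing.isLinear.Build F {malg F[K]} V _ malg_lift malg_lift_linear.

Lemma malg_liftU k : malg_lift << k >> = g k.
Proof.
by rewrite (malg_liftE (msuppU_le (k := k) (x := 1))) big_seq_fset1 mcoeffUU scale1r.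
Qed.

End MalgLift.

Section Presentations.
Variables (F : fieldType) (K : choiceType) (R : {malg F[K]} -> Prop).
Variable M : presentation R.

Definition pres_gen (k : K) : M := pres_pi M << k >>.

Lemma pres_rel r : R r -> pres_pi M r = 0.
Proof.
move=> Rr; apply/pres_ker; rewrite -[r]scale1r -[_ *: _]addr0.
by apply: relation_spanD => //; apply: relation_span0.
Qed.

Lemma pres_ind (P : M -> Prop) :
  P 0 -> (forall c k v, P v -> P (c *: pres_gen k + v)) -> forall v, P v.
Proof.
move=> P0 PD v; have [m <-] := pres_surj v; rewrite (monalgE m).
elim: (X in bigop _ X) => [|k s IHs]; first by rewrite big_nil linear0.
rewrite big_cons linearD -[m@_k]mulr1.
have -> : << m@_k * 1 *g k >> = m@_k *: << k >>.
  by apply/malgP => k'; rewrite mcoeffZ !mcoeffU mulrnAr.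
by rewrite linearZ; apply: PD.
Qed.

Section Lift.
Variables (V : lmodType F) (g : K -> V).

(** The preimage is chosen classically; once [g] respects the relations the choice is immaterial, by
    [pres_lift_pi]. *)
Definition pres_lift (v : M) : V := malg_lift g (sval (cid (pres_surj v))).

Hypothesis gR : forall r, R r -> malg_lift g r = 0.

Lemma malg_lift_span v : relation_span R v -> malg_lift g v = 0.
Proof.
elim=> [|c r {}v Rr _ v0]; first exact: linear0.
by rewrite malg_lift_linear v0 gR // scaler0 addr0.
Qed.

Lemma pres_lift_pi m : pres_lift (pres_pi M m) = malg_lift g m.
Proof.
rewrite /pres_lift; case: cid => m' /= mm'; apply/eqP; rewrite -subr_eq0 -linearB.
by apply/eqP/malg_lift_span/(pres_ker M); rewrite linearB mm' subrr.
Qed.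

Lemma pres_lift_linear a u v : pres_lift (a *: u + v) = a *: pres_lift u + pres_lift v.
Proof.
have [m <-] := pres_surj u; have [m' <-] := pres_surj v.
by rewrite -linearP !pres_lift_pi malg_lift_linear.
Qed.

Lemma pres_lift_gen k : pres_lift (pres_gen k) = g k.
Proof. by rewrite pres_lift_pi malg_liftU. Qed.
End Lift.
End Presentations.

(** * The Lie algebra of the lower central series *)

Section LowerCentral.
Variable G : groupType.
Local Open Scope group_scope.
Implicit Types x y z : G.
Local Notation lc := (@lower_central G).

Lemma generated_min (S N : G -> Prop) : N 1 ->
  (forall x y, N x -> N y -> N (x * y)) -> (forall x, N x -> N x^-1) ->
  (forall x, S x -> N x) -> forall x, generated S x -> N x.
Proof.
move=> N1 NM NV SN x; elim=> [{}x /SN //|//|{}x y _ Nx _ Ny|{}x _ Nx]; last exact: NV.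
exact: NM.
Qed.

Lemma lc1 n : lc n 1.
Proof. by case: n => //= n; apply: generated_one. Qed.
Lemma lcM n x y : lc n x -> lc n y -> lc n (x * y).
Proof. by case: n => //= n; apply: generated_mul. Qed.
Lemma lcV n x : lc n x -> lc n x^-1.
Proof. by case: n => //= n; apply: generated_inv. Qed.

Lemma lcJ n x y : lc n x -> lc n (x ^ y).
Proof.
elim: n x y => //= n IHn x y; move: x.
apply: (@generated_min _ (fun x => lc n.+1 (x ^ y))).
- by rewrite conj1g; apply: generated_one.
- by move=> x z; rewrite conjMg; apply: generated_mul.
- by move=> x; rewrite conjVg; apply: generated_inv.
move=> _ [x [z [lcx ->]]]; rewrite conjRg; apply: generated_in.
by exists (x ^ y), (z ^ y); split=> //; apply: IHn.
Qed.

Lemma lcR n x y : lc n x -> lc n.+1 [~ x, y].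
Proof. by move=> lcx; apply: generated_in; exists x, y. Qed.

Lemma lc_succ n x : lc n.+1 x -> lc n x.
Proof.
elim: n x => [//|n IHn] x; apply: generated_min; [exact: lc1|exact: lcM|exact: lcV|].
by move=> _ [z [y [lcz ->]]]; apply: lcR; apply: IHn.
Qed.

Lemma lc_leq m n x : (m <= n)%N -> lc n x -> lc m x.
Proof.
by move/subnKC<-; elim: (n - m)%N => [|k IHk]; rewrite ?addn0 // addnS => /lc_succ.
Qed.

Lemma commMg_conj x y z : [~ x * y, z] = [~ x, z] ^ y * [~ y, z].
Proof. by rewrite !commgEr conjgM mulgA -conjMg mulgK. Qed.

Lemma commgM_conj x y z : [~ x, y * z] = [~ x, z] * [~ x, y] ^ z.
Proof. by rewrite !commgEl conjgM -mulgA -conjMg mulVKg. Qed.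

Lemma commgV x y : [~ x, y^-1] = ([~ x, y] ^ y^-1)^-1.
Proof.
apply/esym/mulg1_eq/(mulIg [~ x, y^-1]^-1); rewrite mulgK mul1g.
by apply/esym/mulg1_eq; rewrite -commgM_conj mulgV commg1.
Qed.

Lemma hall_witt x y z :
  [~ x, y^-1, z] ^ y * ([~ y, z^-1, x] ^ z * [~ z, x^-1, y] ^ x) = 1.
Proof.
(* Each Hall-Witt factor is a quotient of two consecutive cyclic permutations of this word, so the
   product telescopes. *)
pose a x y z := x * z * y ^ x : G.
have hw u v w : [~ u, v^-1, w] ^ v = (a u v w)^-1 * a v w u.
  rewrite /a /commg /conjg !(invgM, invgK) !mulgA.
  by rewrite ?(mulgK, mulgVK, mulVg, mulgV, mul1g, mulg1).
by rewrite !hw; move: a {hw} => a; rewrite !mulgA !mulgK mulVg.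
Qed.

(** The shift by one is due to [lc i] being the term i + 1 of the series. The induction on j is the
    three subgroups argument: [hall_witt] expresses [[u, v], x] through commutators covered by
    smaller j. *)
Lemma lc_comm i j x y : lc i x -> lc j y -> lc (i + j).+1 [~ x, y].
Proof.
elim: j i x y => [|j IHj] i x y lcx; first by rewrite addn0 => _; apply: lcR.
pose N y := lc (i + j.+1).+1 [~ x, y].
apply: (@generated_min _ N); rewrite /N.
- by rewrite commg1; apply: lc1.
- by move=> u v Nu Nv; rewrite commgM_conj; apply: lcM => //; apply: lcJ.
- by move=> u Nu; rewrite commgV; apply/lcV/lcJ.
move=> _ [u [v [lcu ->]]]; rewrite addnS -invgR; apply: lcV.
have /mulg1_eq/(congr1 (fun t : G => t^-1)) := hall_witt u v^-1 x; rewrite !invgK => hw.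
rewrite -(conjgKV v [~ _, x]) hw; apply/lcJ/lcV/lcM; apply: lcJ.
- rewrite -addSn; apply: IHj => //; rewrite -invgR; apply/lcV/lcR; exact: lcV.
- by apply: lcR; apply: IHj => //; apply: lcV.
Qed.

Section Automorphism.
Variable f : automorphism G.

Lemma autM x y : f (x * y) = f x * f y. Proof. exact: gmulfM. Qed.
Lemma aut1 : f 1 = 1.
Proof. by apply: (mulgI (f 1)); rewrite -autM !mulg1. Qed.
Lemma autV x : f x^-1 = (f x)^-1.
Proof. by apply/esym/mulg1_eq; rewrite -autM mulgV aut1. Qed.
Lemma autR x y : f [~ x, y] = [~ f x, f y].
Proof. by rewrite /commg /conjg !autM !autV. Qed.

Lemma lc_aut n x : lc n x -> lc n (f x).
Proof.
elim: n x => // n IHn x; apply: (@generated_min _ (fun x => lc n.+1 (f x))).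
- by rewrite aut1; apply: lc1.
- by move=> u v; rewrite autM; apply: lcM.
- by move=> u; rewrite autV; apply: lcV.
by move=> _ [u [v [lcu ->]]]; rewrite autR; apply: lcR; apply: IHn.
Qed.
End Automorphism.

Lemma aut_invM (f : automorphism G) : {morph aut_inv f : x y / x * y}.
Proof. exact: can2_gmulfM (aut_funK f) (aut_invK f). Qed.
HB.instance Definition _ (f : automorphism G) :=
  monoid.isMultiplicative.Build G G (aut_inv f) (@aut_invM f).

Definition inverse_automorphism (f : automorphism G) : automorphism G :=
  @Automorphism G (aut_inv f) f (aut_invK f) (aut_funK f).

End LowerCentral.

Section GradedLie.
Variables (F : fieldType) (G : groupType).
Local Notation lc := (@lower_central G).
Local Notation K := (nat * G)%type.
Local Open Scope ring_scope.

(* Generators outside the lower central series are killed, so that all pairs   *)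
(* can serve as generators.                                                    *)
Inductive lie_relation : {malg F[K]} -> Prop :=
| lie_relationM i x y : lc i x -> lc i y ->
    lie_relation (<< (i, (x * y)%g) >> - << (i, x) >> - << (i, y) >>)
| lie_relationS i x : lc i.+1 x -> lie_relation << (i, x) >>
| lie_relationN i x : ~ lc i x -> lie_relation << (i, x) >>.

Variable lie : presentation lie_relation.
Definition lie_gen i x : lie := pres_gen lie (i, x).

Local Notation e := lie_gen.

Lemma lie_genM i x y : lc i x -> lc i y -> e i (x * y)%g = e i x + e i y.
Proof.
move=> lcx lcy; apply/eqP; rewrite -subr_eq0 opprD addrA /lie_gen /pres_gen.
by rewrite -!linearB; apply/eqP/pres_rel/lie_relationM.
Qed.

Lemma lie_genS i x : lc i.+1 x -> e i x = 0.
Proof. by move=> lcx; apply/pres_rel/lie_relationS. Qed.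

Lemma lie_genN i x : ~ lc i x -> e i x = 0.
Proof. by move=> lcx; apply/pres_rel/lie_relationN. Qed.

Lemma lie_gen1 i : e i 1%g = 0.
Proof.
by apply: (addrI (e i 1%g)); rewrite -lie_genM ?mulg1 ?addr0 //; apply: lc1.
Qed.

Lemma lie_genV i x : lc i x -> e i x^-1%g = - e i x.
Proof.
move=> lcx; apply: (addrI (e i x)).
by rewrite -lie_genM ?mulgV ?subrr ?lie_gen1 //; apply: lcV.
Qed.

(** Indeed x ^ y = x * [x, y], and the commutator lies one term deeper, where degree i vanishes. *)
Lemma lie_genJ i x y : lc i x -> e i (x ^ y)%g = e i x.
Proof.
move=> lcx; rewrite -[(x ^ y)%g](mulVKg x) -commgEl.
have lcR' := lcR y lcx; rewrite lie_genM ?(lie_genS lcR') ?addr0 //.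
exact: lc_succ.
Qed.

Lemma lie_ind (P : lie -> Prop) : P 0 ->
  (forall c i x v, lc i x -> P v -> P (c *: e i x + v)) -> forall v, P v.
Proof.
move=> P0 PD; apply: pres_ind => // c [i x] v Pv.
have [lcx|/lie_genN] := pselect (lc i x); first exact: PD.
by rewrite /lie_gen => ->; rewrite scaler0 add0r.
Qed.

Section LieLift.
Variables (V : lmodType F) (g : nat -> G -> V).
Hypothesis gM : forall i x y, lc i x -> lc i y -> g i (x * y)%g = g i x + g i y.
Hypothesis gS : forall i x, lc i.+1 x -> g i x = 0.

Definition lie_lift : lie -> V :=
  pres_lift (fun k => if `[< lc k.1 k.2 >] then g k.1 k.2 else 0).

Let lift_rel r : lie_relation r ->
  malg_lift (fun k => if `[< lc k.1 k.2 >] then g k.1 k.2 else 0) r = 0.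
Proof.
case=> [i x y lcx lcy|i x lcx|i x lcx].
- rewrite !linearB /= !malg_liftU /= !asboolT //; last exact: lcM.
  by rewrite gM // addrAC addrK subrr.
- by rewrite malg_liftU /= gS // if_same.
- by rewrite malg_liftU /= asboolF.
Qed.

Lemma lie_lift_linear a u v : lie_lift (a *: u + v) = a *: lie_lift u + lie_lift v.
Proof. exact: pres_lift_linear. Qed.

Lemma lie_lift_gen i x : lc i x -> lie_lift (e i x) = g i x.
Proof. by move=> lcx; rewrite /lie_lift pres_lift_gen //= asboolT. Qed.
End LieLift.

Section Bracket.
Variables (i j : nat) (x y : G).
Hypotheses (lcx : lc i x) (lcy : lc j y).

Lemma lie_gen_comml x' : lc i x' -> e (i + j).+1 [~ x * x', y]%g =
  e (i + j).+1 [~ x, y]%g + e (i + j).+1 [~ x', y]%g.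
Proof.
move=> lcx'; rewrite commMg_conj lie_genM ?lie_genJ //; last exact: lc_comm.
- exact: lc_comm.
- by apply: lcJ; apply: lc_comm.
Qed.

Lemma lie_gen_commr y' : lc j y' -> e (i + j).+1 [~ x, y * y']%g =
  e (i + j).+1 [~ x, y]%g + e (i + j).+1 [~ x, y']%g.
Proof.
move=> lcy'; rewrite commgM_conj addrC lie_genM ?lie_genJ //; last first.
- by apply: lcJ; apply: lc_comm.
- exact: lc_comm.
- exact: lc_comm.
Qed.
End Bracket.

Definition linear_map (V W : lmodType F) (h : V -> W) :=
  forall a u v, h (a *: u + v) = a *: h u + h v.

Lemma linear_map0 (V W : lmodType F) (h : V -> W) : linear_map h -> h 0 = 0.
Proof.
by move=> hL; apply: (addrI (h 0)); have := hL 1 0 0; rewrite !scale1r !addr0.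
Qed.
Lemma linear_mapD (V W : lmodType F) (h : V -> W) : linear_map h -> {morph h : u v / u + v}.
Proof. by move=> hL u v; have := hL 1 u v; rewrite !scale1r. Qed.
Lemma linear_mapZ (V W : lmodType F) (h : V -> W) a : linear_map h -> {morph h : u / a *: u}.
Proof. by move=> hL u; have := hL a u 0; rewrite (linear_map0 hL) !addr0. Qed.

Lemma lie_linear_ext (V : lmodType F) (h h' : lie -> V) :
  linear_map h -> linear_map h' -> (forall i x, lc i x -> h (e i x) = h' (e i x)) ->
  h =1 h'.
Proof.
move=> hL hL' hh'; apply: lie_ind; first by rewrite !linear_map0.
by move=> c i x v lcx hv; rewrite hL hL' hh' ?hv.
Qed.

Definition lie_ad i x : lie -> lie := lie_lift (fun j y => e (i + j).+1 [~ x, y]%g).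

Section Ad.
Variables (i : nat) (x : G).
Hypothesis lcx : lc i x.

Let adS j y : lc j.+1 y -> e (i + j).+1 [~ x, y]%g = 0.
Proof. by move=> lcy; apply: lie_genS; rewrite -addnS; apply: lc_comm. Qed.

Lemma lie_ad_linear : linear_map (lie_ad i x).
Proof.
by move=> a u v; apply: lie_lift_linear => [j y y' lcy lcy'|j y]; [apply: lie_gen_commr | apply: adS].
Qed.

Lemma lie_ad_gen j y : lc j y -> lie_ad i x (e j y) = e (i + j).+1 [~ x, y]%g.
Proof.
by move=> lcy; apply: lie_lift_gen => // k z z' lcz lcz'; apply: lie_gen_commr.
Qed.
End Ad.

Lemma lie_adM i x x' v : lc i x -> lc i x' ->
  lie_ad i (x * x')%g v = lie_ad i x v + lie_ad i x' v.
Proof.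
move=> lcx lcx'; have lcM' := lcM lcx lcx'.
move: v; apply: lie_linear_ext; first exact: lie_ad_linear.
  by move=> a u v; rewrite !lie_ad_linear // scalerDr addrACA.
by move=> j y lcy; rewrite !lie_ad_gen // lie_gen_comml.
Qed.

Lemma lie_adS i x v : lc i.+1 x -> lie_ad i x v = 0.
Proof.
move=> lcx; move: v; apply: (@lie_linear_ext _ _ (fun _ => 0)).
- by apply: lie_ad_linear; apply: lc_succ.
- by move=> a u v; rewrite scaler0 addr0.
move=> j y lcy; rewrite lie_ad_gen //; last exact: lc_succ.
by apply: lie_genS; rewrite -addSn; apply: lc_comm.
Qed.

(** The universal property is used twice: [lie_ad] extends the commutator in its second argument,
    and [lie_adM] and [lie_adS] allow the extension in the first. *)
Definition lie_br u v : lie := lie_lift (fun i x => lie_ad i x v) u.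

Lemma lie_br_linear v : linear_map (lie_br^~ v).
Proof.
by move=> a u w; apply: lie_lift_linear => [i x y|i x]; [apply: lie_adM | apply: lie_adS].
Qed.

Lemma lie_br_ad i x v : lc i x -> lie_br (e i x) v = lie_ad i x v.
Proof.
by move=> lcx; apply: (lie_lift_gen _ _ lcx) => [j y y'|j y]; [apply: lie_adM | apply: lie_adS].
Qed.

Lemma lie_br_gen i j x y : lc i x -> lc j y ->
  lie_br (e i x) (e j y) = e (i + j).+1 [~ x, y]%g.
Proof. by move=> lcx lcy; rewrite lie_br_ad // lie_ad_gen. Qed.

Lemma lie_br_linearr u : linear_map (lie_br u).
Proof.
move=> a v w; move: u; apply: lie_linear_ext; first exact: lie_br_linear.
  move=> b u u'; rewrite (lie_br_linear v b) (lie_br_linear w b).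
  by rewrite !scalerDr !scalerA (mulrC a) addrACA.
by move=> i x lcx; rewrite !lie_br_ad // lie_ad_linear.
Qed.

Lemma lie_brC u v : lie_br u v = - lie_br v u.
Proof.
move: u; apply: lie_linear_ext; first exact: lie_br_linear.
  by move=> a u w; rewrite lie_br_linearr opprD scalerN.
move=> i x lcx; move: v; apply: lie_linear_ext; first exact: lie_br_linearr.
  by move=> a u w; rewrite lie_br_linear opprD scalerN.
move=> j y lcy; rewrite !lie_br_gen // -invgR lie_genV ?(addnC i) //.
exact: lc_comm.
Qed.

Lemma lie_brNr u v : lie_br u (- v) = - lie_br u v.
Proof. by rewrite -scaleN1r (linear_mapZ _ (lie_br_linearr u)) scaleN1r. Qed.
Lemma lie_brNl u v : lie_br (- u) v = - lie_br u v.
Proof. by rewrite lie_brC lie_brNr -lie_brC. Qed.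

Lemma lie_jacobi u v w :
  lie_br (lie_br u v) w + lie_br (lie_br v w) u + lie_br (lie_br w u) v = 0.
Proof.
have brL := lie_br_linear; have brR := lie_br_linearr.
have zeroL : linear_map (fun _ : lie => 0 : lie).
  by move=> a ? ?; rewrite scaler0 addr0.
have sum3 (V : lmodType F) (h1 h2 h3 : lie -> V) : linear_map h1 -> linear_map h2 ->
    linear_map h3 -> linear_map (fun t => h1 t + h2 t + h3 t).
  move=> L1 L2 L3 a t t'; rewrite L1 L2 L3 !scalerDr.
  by rewrite [X in X + _ = _]addrACA [LHS]addrACA.
move: u; apply: lie_linear_ext => //.
  by apply: sum3 => a t t'; rewrite ?brR ?brL ?brR.
move=> i x lcx; move: v; apply: lie_linear_ext => //.
  by apply: sum3 => a t t'; rewrite ?brR ?brL ?brR.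
move=> j y lcy; move: w; apply: lie_linear_ext => //.
  by apply: sum3 => a t t'; rewrite ?brR ?brL ?brR.
move=> k z lcz.
(* On generators the double brackets are the Hall-Witt factors up to sign: inverting [x2] changes
   the sign, and conjugating by [x2] does not change the class. *)
have tri i1 i2 i3 x1 x2 x3 : lc i1 x1 -> lc i2 x2 -> lc i3 x3 ->
  lie_br (lie_br (e i1 x1) (e i2 x2)) (e i3 x3) =
  - e ((i1 + i2).+1 + i3).+1 ([~ x1, x2^-1, x3] ^ x2)%g.
  move=> lc1 lc2 lc3; have lc12 := lc_comm lc1 (lcV lc2).
  rewrite lie_genJ; last exact: lc_comm.
  rewrite -lie_br_gen // -lie_br_gen //; last exact: lcV.
  by rewrite lie_genV // lie_brNr lie_brNl opprK.
rewrite !tri // -!opprD.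
have -> : ((j + k).+1 + i = (i + j).+1 + k)%N by rewrite !addSn addnC addnA.
have -> : ((k + i).+1 + j = (i + j).+1 + k)%N by rewrite !addSn -addnA addnC.
have lc3 i1 i2 i3 x1 x2 x3 : lc i1 x1 -> lc i2 x2 -> lc i3 x3 ->
    (i1 + i2 + i3 = i + j + k)%N ->
    lc ((i + j).+1 + k).+1 ([~ x1, x2^-1, x3] ^ x2)%g.
  move=> lc1 lc2 lc3; rewrite addSn => <-; apply: lcJ; rewrite -addSn.
  by apply: lc_comm => //; apply: lc_comm => //; apply: lcV.
have h1 := lc3 _ _ _ _ _ _ lcx lcy lcz (erefl _).
have h2 : lc ((i + j).+1 + k).+1 ([~ y, z^-1, x] ^ z)%g.
  by apply: (lc3 j k i) => //; rewrite addnC addnA.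
have h3 : lc ((i + j).+1 + k).+1 ([~ z, x^-1, y] ^ x)%g.
  by apply: (lc3 k i j) => //; rewrite -addnA addnC.
rewrite -addrA -(lie_genM h2 h3) -(lie_genM h1 (lcM h2 h3)).
by rewrite hall_witt lie_gen1 oppr0.
Qed.

Lemma lie_brJ u v w :
  lie_br u (lie_br v w) = lie_br (lie_br u v) w - lie_br (lie_br u w) v.
Proof.
have := lie_jacobi u v w; rewrite (lie_brC w u) lie_brNl [lie_br (lie_br v w) u]lie_brC.
by move/eqP; rewrite addrAC subr_eq0 => /eqP->.
Qed.

Lemma lie_brDl u v w : lie_br (u + v) w = lie_br u w + lie_br v w.
Proof. exact: (linear_mapD (lie_br_linear w)). Qed.
Lemma lie_brDr u v w : lie_br w (u + v) = lie_br w u + lie_br w v.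
Proof. exact: (linear_mapD (lie_br_linearr w)). Qed.
End GradedLie.

(** * Torsion in the factors of the lower central series *)

Section IntPowers.
Local Open Scope group_scope.
Variable G : groupType.
Implicit Types (x y : G) (a b : int).

Lemma expgz_succ x a : expgz x (a + 1)%R = expgz x a * x.
Proof.
case: a => [n|[|n]]; first by rewrite addrC -intS /= expgSr.
  by rewrite /= expg1 mulVg.
have -> : (Negz n.+1 + 1)%R = Negz n by rewrite !NegzE [in LHS]intS opprD addrAC addNr add0r.
by rewrite /= [in RHS]expgS invgM mulgVK.
Qed.

Lemma expgz_pred x a : expgz x (a - 1)%R = expgz x a * x^-1.
Proof. by apply: (mulIg x); rewrite -expgz_succ subrK mulgVK. Qed.

Lemma expgzD x a b : expgz x (a + b)%R = expgz x a * expgz x b.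
Proof.
elim/int_ind: b => [|n IHn|n IHn]; first by rewrite addr0 mulg1.
  by rewrite intS [(1 + _)%R]addrC addrA !expgz_succ IHn mulgA.
by rewrite -addn1 PoszD opprD addrA !expgz_pred IHn mulgA.
Qed.

End IntPowers.

Section Torsion.
Variables (G : groupType) (n : nat).
Local Notation lc := (@lower_central G).
Local Notation K := (nat * G)%type.
Local Open Scope group_scope.

Definition lc_cong (u v : G) := lc n.+1 (u^-1 * v).

Lemma lc_congM u u' v v' : lc_cong u v -> lc_cong u' v' -> lc_cong (u * u') (v * v').
Proof.
rewrite /lc_cong => uv uv'.
have -> : (u * u')^-1 * (v * v') = (u^-1 * v) ^ u' * (u'^-1 * v').
  by rewrite invgM conjgE !mulgA mulgK.
by apply: lcM => //; apply: lcJ.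
Qed.

Lemma lc_cong_sym u v : lc_cong u v -> lc_cong v u.
Proof. by move/lcV; rewrite invgM invgK. Qed.
Lemma lc_cong_trans u v w : lc_cong u v -> lc_cong v w -> lc_cong u w.
Proof. by move=> uv vw; have := lcM uv vw; rewrite mulgA mulgK. Qed.
Lemma lc_cong_refl u : lc_cong u u.
Proof. by rewrite /lc_cong mulVg; apply: lc1. Qed.
Lemma lc_congC u v : lc n u -> lc_cong (u * v) (v * u).
Proof.
move=> lcu; apply: lc_cong_sym; rewrite /lc_cong invgM -mulgA mulgA.
by have := lcR v lcu; rewrite /commg /conjg !mulgA.
Qed.

(** Realizes a generator of degree n in the group; the generators of other degrees, or outside
    [lc n], become 1. *)
Definition layer (k : K) : G := if (k.1 == n) && `[< lc n k.2 >] then k.2 else 1.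

Lemma layer_lc k a : lc n (expgz (layer k) a).
Proof.
have lck : lc n (layer k).
  by rewrite /layer; case: ifP => [/andP[_ /asboolP]|_] //; apply: lc1.
case: a => m /=.
  by elim: m => [|m IHm]; [apply: lc1 | rewrite expgS; apply: lcM].
by apply: lcV; elim: m => [|m IHm]; [rewrite expg1 | rewrite expgS; apply: lcM].
Qed.

(* A homomorphism modulo [lc n.+1] from the free abelian group on [d]. *)
Definition layer_prod (d : seq K) (z : K -> int) : G :=
  \prod_(k <- d) expgz (layer k) (z k).

Lemma layer_prodD d z z' : lc_cong (layer_prod d (fun k => (z k + z' k)%R))
  (layer_prod d z * layer_prod d z').
Proof.
rewrite /layer_prod; elim: d => [|k d IHd]; rewrite ?big_nil ?big_cons.
  by rewrite mulg1; apply: lc_cong_refl.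
rewrite expgzD; set A := expgz _ _; set B := expgz _ _.
apply: lc_cong_trans (lc_congM (lc_cong_refl (A * B)) IHd) _.
rewrite -!mulgA; apply: lc_congM; first exact: lc_cong_refl.
rewrite !mulgA; apply: lc_congM; last exact: lc_cong_refl.
by apply: lc_congC; apply: layer_lc.
Qed.

Lemma layer_prodB d z z' : lc n.+1 (layer_prod d z) -> lc n.+1 (layer_prod d z') ->
  lc n.+1 (layer_prod d (fun k => (z k - z' k)%R)).
Proof.
move=> lcz lcz'; have := layer_prodD d (fun k => (z k - z' k)%R) z'.
have -> : layer_prod d (fun k => (z k - z' k + z' k)%R) = layer_prod d z.
  by apply: eq_bigr => k _; rewrite subrK.
move/(lcM lcz); rewrite mulVKg => /lcM/(_ (lcV lcz')).
by rewrite mulgK.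
Qed.

Lemma layer_prod_unit d k a : uniq d -> k \in d ->
  layer_prod d (fun k' => a *+ (k' == k))%R = expgz (layer k) a.
Proof.
move=> + dk; rewrite /layer_prod; elim: d dk => // k' d IHd.
rewrite in_cons big_cons /= => /predU1P[<-|dk] /andP[k'd d_uniq].
  rewrite eqxx big_seq big1 ?mulg1 // => k1 dk1.
  by have /negPf-> : k1 != k by apply: contraNneq k'd => <-.
rewrite IHd //; have /negPf-> : k' != k by apply: contraNneq k'd => ->.
by rewrite mul1g.
Qed.

Lemma layer_prod0 d : layer_prod d (fun=> 0%R) = 1.
Proof. by rewrite /layer_prod big1. Qed.

Definition layer_trivial d z := lc n.+1 (layer_prod d z).

Lemma layer_trivial_eq d z z' : {in d, z =1 z'} ->
  layer_trivial d z -> layer_trivial d z'.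
Proof.
move=> zz'; rewrite /layer_trivial /layer_prod.
by rewrite (eq_big_seq (fun k => expgz (layer k) (z' k))) // => k /zz' ->.
Qed.

Lemma layer_trivialN d z : layer_trivial d z -> layer_trivial d (fun k => - z k)%R.
Proof.
move=> tz; apply: (@layer_trivial_eq _ (fun k => 0 - z k)%R) => [k _|]; first exact: sub0r.
by apply: layer_prodB => //; rewrite layer_prod0; apply: lc1.
Qed.

Lemma layer_trivialD d z z' : layer_trivial d z -> layer_trivial d z' ->
  layer_trivial d (fun k => z k + z' k)%R.
Proof.
move=> tz /layer_trivialN tz'.
apply: (@layer_trivial_eq _ (fun k => z k - (- z' k))%R) => [k _|]; first by rewrite opprK.
exact: layer_prodB.
Qed.

Lemma layer_trivialM d b z : layer_trivial d z -> layer_trivial d (fun k => b * z k)%R.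
Proof.
move=> tz; elim/int_ind: b => [|m IHm|m IHm].
- apply: (@layer_trivial_eq _ (fun=> 0)%R) => [k _|]; first by rewrite mul0r.
  by rewrite /layer_trivial layer_prod0; apply: lc1.
- apply: layer_trivial_eq (layer_trivialD tz IHm) => k _.
  by rewrite intS mulrDl mul1r.
- apply: layer_trivial_eq (layer_trivialD (layer_trivialN tz) IHm) => k _.
  by rewrite intS opprD mulrDl mulN1r.
Qed.

Lemma layer_trivial_sum d q (b : 'I_q -> int) (zs : 'I_q -> K -> int) :
  (forall j, layer_trivial d (zs j)) ->
  layer_trivial d (fun k => \sum_(j < q) b j * zs j k)%R.
Proof.
elim: q b zs => [|q IHq] b zs tz.
  apply: (@layer_trivial_eq _ (fun=> 0)%R) => [k _|]; first by rewrite big_ord0.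
  by rewrite /layer_trivial layer_prod0; apply: lc1.
apply: layer_trivial_eq (layer_trivialD (layer_trivialM (b ord0) (tz ord0))
  (IHq (fun j => b (lift ord0 j)) (fun j => zs (lift ord0 j)) _)) => [k _|j].
  by rewrite big_ord_recl.
exact: tz.
Qed.

Section Relations.
Variable F : fieldType.
Local Open Scope ring_scope.

(** The relations have integer coefficients and already hold in the group modulo [lc n.+1]. Any list
    containing [s] is allowed, so that several relations can be evaluated on a common list. *)
Lemma relation_integral (r : {malg F[K]}) : lie_relation r ->
  exists (z : K -> int) (s : seq K), (forall k, r@_k = (z k)%:~R) /\
    forall d, uniq d -> {subset s <= d} -> layer_trivial d z.
Proof.
pose u (k k' : K) : int := 1 *+ (k' == k).
have uE k k' : (<< k >> : {malg F[K]})@_k' = (u k k')%:~R.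
  by rewrite mcoeffU /u eq_sym; case: (k' == k).
case=> [i x y lcx lcy|i x lcx|i x lcx].
- pose kx := (i, x); pose ky := (i, y); pose kxy := (i, (x * y)%g).
  exists (fun k => u kxy k - (u kx k + u ky k)), [:: kxy; kx; ky]; split=> [k|d d_uniq sd].
    by rewrite !mcoeffB !uE opprD addrA !rmorphB.
  have dk k : k \in [:: kxy; kx; ky] -> layer_prod d (u k) = layer k.
    by move=> /sd dk; rewrite layer_prod_unit //= expg1.
  have := layer_prodD d (fun k => u kxy k - (u kx k + u ky k)) (fun k => u kx k + u ky k).
  have -> : layer_prod d (fun k => u kxy k - (u kx k + u ky k) + (u kx k + u ky k)) =
      layer_prod d (u kxy) by apply: eq_bigr => k _; rewrite subrK.
  rewrite dk ?mem_head // => h1.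
  have := layer_prodD d (u kx) (u ky); rewrite !dk ?inE ?eqxx ?orbT // => h2.
  have := lc_cong_trans h1 (lc_congM (lc_cong_refl _) h2).
  have -> : layer kxy = (layer kx * layer ky)%g.
    rewrite /layer /=; have [<-|_] := eqVneq i n; last by rewrite mulg1.
    by rewrite !asboolT //; apply: lcM.
  by rewrite /lc_cong -conjgE => /(lcJ (layer kx * layer ky)^-1); rewrite conjgK.
- exists (u (i, x)), [:: (i, x)]; split=> [k|d d_uniq sd]; first exact: uE.
  rewrite /layer_trivial layer_prod_unit ?sd ?mem_head //= expg1 /layer /=.
  by have [<-|_] := eqVneq i n; [case: asboolP => // _|]; apply: (@lc1 G _.+1).
exists (u (i, x)), [:: (i, x)]; split=> [k|d d_uniq sd]; first exact: uE.
rewrite /layer_trivial layer_prod_unit ?sd ?mem_head //= expg1 /layer /=.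
by have [<-|_] := eqVneq i n; [rewrite asboolF //|]; apply: (@lc1 G _.+1).
Qed.

Lemma span_integral (v : {malg F[K]}) : relation_span (@lie_relation F G) v ->
  exists (q : nat) (c : 'I_q -> F) (z : 'I_q -> K -> int) (s : seq K),
    (forall k, v@_k = \sum_j c j * (z j k)%:~R) /\
    forall d, uniq d -> {subset s <= d} -> forall j, layer_trivial d (z j).
Proof.
elim=> [|c r {}v /relation_integral[z [s [rz zs]]] _ [q [c' [z' [s' [vz zs']]]]]].
  exists 0, (fun=> 0), (fun _ _ => 0), [::]; split=> [k|d _ _ []//].
  by rewrite mcoeff0 big_ord0.
exists q.+1, (fun j => if unlift ord0 j is Some j' then c' j' else c).
exists (fun j => if unlift ord0 j is Some j' then z' j' else z), (s ++ s').
split=> [k|d d_uniq sd j].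
  rewrite mcoeffD mcoeffZ rz vz big_ord_recl unlift_none; congr (_ + _).
  by apply: eq_bigr => j _; rewrite liftK.
case: unliftP => [j' _|_].
  by apply: zs' => // k sk; apply: sd; rewrite mem_cat sk orbT.
by apply: zs => // k sk; apply: sd; rewrite mem_cat sk.
Qed.
End Relations.

Local Open Scope ring_scope.

Lemma common_denominator q (a : 'I_q -> rat) :
  exists (m : nat) (b : 'I_q -> int), (0 < m)%N /\ forall j, m%:R * a j = (b j)%:~R.
Proof.
elim: q a => [|q IHq] a; first by exists 1%N, (fun=> 0); split=> // [[]].
have [m [b [m0 mb]]] := IHq (fun j => a (lift ord0 j)).
have [d d0 dE] : exists2 d : nat, (0 < d)%N & denq (a ord0) = d.
  by have := denq_gt0 (a ord0); case: (denq _) => // d; exists d.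
exists (d * m)%N.
exists (fun j => if unlift ord0 j is Some j' then d%:Z * b j' else m%:Z * numq (a ord0)).
split=> [|j]; first by rewrite muln_gt0 d0.
rewrite natrM; case: unliftP => [j' ->|->].
  by rewrite -mulrA mb intrM.
have aE : a ord0 = (numq (a ord0))%:~R / d%:R by rewrite -[LHS]divq_num_den dE.
rewrite [in LHS]aE intrM mulrAC mulrC; congr (_ * _).
by rewrite mulrC divfK // pnatr_eq0 -lt0n.
Qed.

(** A vanishing generator is an [F]-combination of integral relations, hence a rational one.
    Clearing denominators makes a positive multiple an integer combination, and this can be read in
    the group modulo [lc n.+1]. *)
Theorem lie_gen_torsion (F : numFieldType) (L : presentation (@lie_relation F G)) x :
  lc n x -> lie_gen L n x = 0 ->
  exists2 m, (0 < m)%N & lc n.+1 (x ^+ m)%g.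
Proof.
move=> lcx /pres_ker/span_integral[q [c [z [s [xz zs]]]]].
pose k0 : K := (n, x); pose d := undup (k0 :: s).
have dk0 : k0 \in d by rewrite mem_undup mem_head.
have sd : {subset s <= d} by move=> k sk; rewrite mem_undup in_cons sk orbT.
have tz := zs d (undup_uniq _) sd.
pose dn (i : 'I_(size d)) := nth k0 d i.
pose P : 'M[rat]_(q, size d) := \matrix_(j, i) (z j (dn i))%:~R.
pose u : 'rV[rat]_(size d) := \row_i (dn i == k0)%:R.
have : (u <= P)%MS.
  (* The rows of [P] are the relations, its columns the generators in [d]. Membership in a row space
     is insensitive to field extension, so it descends from [F] to the rationals. *)
  rewrite -(map_submx (@ratr F)); apply/submxP; exists (\row_j c j).
  apply/rowP => i; rewrite !mxE rmorph_nat.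
  have := xz (dn i); rewrite mcoeffU eq_sym => ->; apply: eq_bigr => j _.
  by rewrite !mxE rmorph_int.
case/submxP => a ua; have [m [b [m0 mb]]] := common_denominator (a ord0).
exists m => //.
have := layer_trivial_sum b tz.
move/(@layer_trivial_eq _ _ (fun k => m%:Z *+ (k == k0))).
rewrite /layer_trivial layer_prod_unit ?undup_uniq // /layer /= eqxx asboolT //=.
apply=> k dk; apply: (@intr_inj rat).
have [i ->] : exists i, k = dn i.
  have ik : (index k d < size d)%N by rewrite index_mem.
  by exists (Ordinal ik); rewrite /dn /= nth_index.
rewrite rmorph_sum rmorphMn /= -mulr_natr -pmulrn.
have := congr1 (fun r : 'rV_(size d) => m%:R * r ord0 i) ua; rewrite !mxE.
rewrite mulr_sumr => ->; apply: eq_bigr => j _.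
by rewrite mxE mulrA mb intrM.
Qed.
End Torsion.

(** * Generalized eigenspaces *)

Section SumOfComponents.
Variables (K : fieldType) (L : zmodType).

Inductive fam_sum (V : family K L) : L -> Prop :=
| fam_sum0 : fam_sum V 0
| fam_sumD a u v : V a u -> fam_sum V v -> fam_sum V (u + v).

Lemma fam_sum_add V u v : fam_sum V u -> fam_sum V v -> fam_sum V (u + v).
Proof.
by elim=> [|a {}u w Vu _ IHw] Vv; rewrite ?add0r // -addrA; apply: fam_sumD Vu (IHw Vv).
Qed.

Lemma fam_sum_in V a u : V a u -> fam_sum V u.
Proof. by move=> Vu; rewrite -[u]addr0; apply: fam_sumD Vu (fam_sum0 V). Qed.
End SumOfComponents.

Section GeneralizedEigenspaces.
Variables (F : fieldType) (V : lmodType F) (phi : V -> V).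
Hypothesis phiL : linear_map phi.

Definition shifted a v := phi v - a *: v.
Definition geig : family F V := fun a v => exists n, iter n (shifted a) v = 0.

Lemma shifted_linear a : linear_map (shifted a).
Proof.
move=> b u v; rewrite /shifted phiL scalerDr opprD addrACA scalerBr !scalerA.
by rewrite mulrC.
Qed.

Lemma iter_linear (h : V -> V) n : linear_map h -> linear_map (iter n h).
Proof. by move=> hL; elim: n => [|n IHn] b u v //=; rewrite IHn hL. Qed.

Lemma iter_shifted0 a m n v : iter m (shifted a) v = 0 -> iter (n + m) (shifted a) v = 0.
Proof.
by move=> v0; rewrite iterD v0; apply/linear_map0/iter_linear/shifted_linear.
Qed.

Lemma geig_add : additive_family geig.
Proof.
split=> [a|a u v [m u0] [n v0]]; first by exists 0%N.
exists (n + m)%N; rewrite -scaleN1r addrC (iter_linear _ (shifted_linear a)).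
by rewrite (iter_shifted0 n u0) addnC (iter_shifted0 m v0) scaler0 addr0.
Qed.

Lemma geigP a n v : geig a (iter n (shifted a) v) -> geig a v.
Proof. by case=> m; rewrite -iterD => v0; exists (m + n)%N. Qed.

(** On the generalized eigenspace of a, [shifted b] is the nonzero scalar a - b plus a locally
    nilpotent map; the preimage is built by induction on the nilpotency exponent. *)
Lemma geig_shifted_surj a b w : a != b -> geig a w ->
  exists2 u, geig a u & shifted b u = w.
Proof.
move=> ab [n]; elim: n w => [|n IHn] w.
  by move=> /= ->; exists 0; [exact: (fam0 geig_add) | exact: (linear_map0 (shifted_linear b))].
rewrite iterSr => w0; have [u au uE] := IHn _ w0.
have ba : a - b != 0 by rewrite subr_eq0.
have aw : geig a w by exists n.+1; rewrite iterSr.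
exists ((a - b)^-1 *: (w - u)).
  case: (famB geig_add aw au) => m m0; exists m.
  by rewrite (linear_mapZ _ (iter_linear m (shifted_linear a))) m0 scaler0.
rewrite (linear_mapZ _ (shifted_linear b)).
have -> : shifted b (w - u) = (a - b) *: w.
  rewrite -[w - u]addrC -scaleN1r shifted_linear uE scaleN1r /shifted.
  by rewrite opprB addrA subrK scalerBl.
by rewrite scalerA mulVf ?scale1r.
Qed.

(** The parts of [shifted b v] of weight other than b are lifted to some u in the sum. The remainder
    [shifted b (v - u)] has weight b, so one more power of [shifted b] kills v - u. *)
Lemma fam_sum_shifted b v : fam_sum geig (shifted b v) -> fam_sum geig v.
Proof.
suff sum_shift w : fam_sum geig w -> exists2 u, fam_sum geig u & geig b (w - shifted b u).
  case/sum_shift => u su [n n0].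
  rewrite -[v](subrK u); apply: fam_sum_add su; apply: (@fam_sum_in _ _ _ b).
  exists n.+1; rewrite iterSr -[v - u]addrC -scaleN1r shifted_linear scaleN1r.
  by rewrite addrC.
elim=> [|a {}u {}w au _ [u' su' bw]].
  exists 0; first exact: fam_sum0.
  by rewrite (linear_map0 (shifted_linear b)) subr0; apply: (fam0 geig_add).
have [ab|ab] := eqVneq a b.
  by exists u' => //; rewrite -addrA; apply: (famD geig_add _ bw); rewrite -ab.
have [u1 au1 u1E] := geig_shifted_surj ab au.
exists (u1 + u'); first exact: fam_sumD au1 su'.
by rewrite (linear_mapD (shifted_linear b)) u1E opprD addrACA subrr add0r.
Qed.

Definition poly_act (p : {poly F}) v := \sum_(i < size p) p`_i *: iter i phi v.

Lemma poly_actE n (p : {poly F}) v : (size p <= n)%N -> poly_act p v = \sum_(i < n) p`_i *: iter i phi v.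
Proof.
move=> pn; rewrite /poly_act (big_ord_widen n (fun i => p`_i *: iter i phi v) pn).
rewrite [RHS](bigID (fun i : 'I_n => (i < size p)%N)) /= [X in _ = _ + X]big1 ?addr0 //.
by move=> i; rewrite -leqNgt => pi; rewrite nth_default ?scale0r.
Qed.

Lemma poly_act_linear v : linear_map (V := {poly F}) (poly_act^~ v).
Proof.
move=> a p q; pose n := maxn (size (a *: p + q)) (maxn (size p) (size q)).
rewrite !(@poly_actE n) ?leq_max ?leqnn ?orbT // scaler_sumr -big_split /=.
by apply: eq_bigr => i _; rewrite coefD coefZ scalerDl scalerA.
Qed.

Lemma poly_actXn n v : poly_act 'X^n v = iter n phi v.
Proof.
rewrite (@poly_actE n.+1) ?size_polyXn // big_ord_recr /= coefXn eqxx scale1r.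
by rewrite big1 ?add0r // => i _; rewrite coefXn ltn_eqF ?scale0r.
Qed.

Lemma poly_act1 v : poly_act 1 v = v.
Proof. by have := poly_actXn 0 v. Qed.

Lemma poly_actM p a v : poly_act (('X - a%:P) * p) v = poly_act p (shifted a v).
Proof.
have sz : (size (('X - a%:P) * p)%R <= (size p).+1)%N.
  by rewrite (leq_trans (size_polyMleq _ _)) // size_XsubC.
rewrite (poly_actE v sz) /poly_act big_ord_recl.
under eq_bigr => i _ do rewrite mulrBl coefB coefXM coefCM /= add0n scalerBl.
rewrite sumrB mulrBl coefB coefXM coefCM /= sub0r addrCA.
have -> : - (a * p`_0) *: v - \sum_(i < size p) (a * p`_(bump 0 i)) *: phi (iter i phi v) =
    - \sum_(i < size p) (a * p`_i) *: iter i phi v.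
  rewrite scaleNr -opprD; congr (- _).
  transitivity (\sum_(i < (size p).+1) (a * p`_i) *: iter i phi v).
    by rewrite big_ord_recl.
  by rewrite big_ord_recr /= nth_default // mulr0 scale0r addr0.
rewrite -sumrB; apply: eq_bigr => i _.
have -> : shifted a v = (- a) *: v + phi v by rewrite /shifted addrC scaleNr.
by rewrite (iter_linear i phiL) -iterSr /= scalerDr scalerA mulrN scaleNr (mulrC a) addrC.
Qed.

Lemma poly_act_prod0 (rs : seq F) v :
  poly_act (\prod_(a <- rs) ('X - a%:P)) v = 0 -> fam_sum geig v.
Proof.
elim: rs v => [|a rs IHrs] v; first by rewrite big_nil poly_act1 => ->; apply: fam_sum0.
by rewrite big_cons poly_actM => /IHrs; apply: fam_sum_shifted.
Qed.

(** Descending on the exponent leaves the case of an eigenvector, on which p acts as the nonzero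
    scalar p(a). *)
Lemma geig_root p a v : (forall v, poly_act p v = 0) -> ~~ root p a -> geig a v -> v = 0.
Proof.
move=> p0 pa [n]; elim: n v => // n IHn v; rewrite iterSr => /IHn.
move/eqP; rewrite subr_eq0 => /eqP phiv.
have iter_phi i : iter i phi v = a ^+ i *: v.
  by elim: i => [|i IHi] /=; rewrite ?scale1r // IHi (linear_mapZ _ phiL) phiv scalerA exprSr.
have := p0 v; rewrite /poly_act.
under eq_bigr => i _ do rewrite iter_phi scalerA.
rewrite -scaler_suml -horner_coef => /eqP; rewrite scaler_eq0 => /orP[pa0|/eqP//].
by rewrite /root pa0 in pa.
Qed.

(** The polynomial of the identity may vanish at 0, when the coefficients of its lowest exponent
    cancel; weight 0 is therefore excluded by injectivity. *)
Lemma geig0 v : injective phi -> geig 0 v -> v = 0.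
Proof.
move=> phiI [n]; elim: n v => // n IHn v; rewrite iterSr => /IHn.
rewrite /shifted scale0r subr0 => phiv.
by apply: phiI; rewrite phiv (linear_map0 phiL).
Qed.

Lemma geigZ a c v : geig a v -> geig a (c *: v).
Proof.
case=> n v0; exists n.
by rewrite (linear_mapZ _ (iter_linear n (shifted_linear a))) v0 scaler0.
Qed.

Lemma iter_shifted_phi a n v : iter n (shifted a) (phi v) = phi (iter n (shifted a) v).
Proof.
elim: n => //= n ->; rewrite /shifted [in RHS]addrC -[in RHS]scaleNr phiL.
by rewrite scaleNr addrC.
Qed.

(** Induction on the sum of the two exponents, since (phi - a b)[u, v] = [(phi - a) u, phi v] + a
    [u, (phi - b) v] and phi preserves the exponent of v. *)
Lemma geig_br (br : V -> V -> V) :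
  (forall u, linear_map (br u)) -> (forall v, linear_map (br^~ v)) ->
  (forall u v, phi (br u v) = br (phi u) (phi v)) -> closed_under br geig geig.
Proof.
move=> brR brL phibr a b u v [m u0] [n v0].
have [k] := ubnP (m + n)%N.
elim: k => // k IHk in m n u v u0 v0 *; rewrite ltnS => mnk.
case: m u0 mnk => [/= -> _|m u0 mnk].
  by rewrite (linear_map0 (brL v)); apply: (fam0 geig_add).
case: n v0 mnk => [/= -> _|n v0 mnk].
  by rewrite (linear_map0 (brR u)); apply: (fam0 geig_add).
have linB h x (c : F) (y : V) : linear_map h -> h (x - c *: y) = h x - c *: h y :> V.
  by move=> hL; rewrite -scaleNr addrC hL scaleNr addrC.
apply: (@geigP _ 1); have -> : iter 1 (shifted (a * b)) (br u v) =
    br (shifted a u) (phi v) + a *: br u (shifted b v).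
  rewrite /= /shifted (linB _ _ _ _ (brL _)) (linB _ _ _ _ (brR _)) phibr.
  by rewrite scalerBr scalerA addrA subrK.
apply: (famD geig_add).
  apply: (IHk m n.+1) => //.
    by move: u0; rewrite iterSr.
  by rewrite iter_shifted_phi v0 (linear_map0 phiL).
apply/geigZ/(IHk m.+1 n) => //; last by rewrite -addnS.
by move: v0; rewrite iterSr.
Qed.

End GeneralizedEigenspaces.

(** * The action of the automorphism *)

Section AutomorphismPowers.
Local Open Scope group_scope.
Variables (G : groupType) (f : automorphism G).
Local Notation lc := (@lower_central G).

Lemma aut_expz_succ a x : aut_expz f (a + 1)%R x = f (aut_expz f a x).
Proof.
case: a => [n|[|n]]; first by rewrite addrC -intS.
  by rewrite /= aut_invK.
have -> : (Negz n.+1 + 1)%R = Negz n by rewrite !NegzE [in LHS]intS opprD addrAC addNr add0r.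
by rewrite [in RHS]/aut_expz iterS aut_invK.
Qed.

Lemma aut_expzDn a n x : aut_expz f (a + n%:Z)%R x = iter n f (aut_expz f a x).
Proof.
elim: n => [|n IHn]; first by rewrite addr0.
by rewrite intS [(1 + _)%R]addrC addrA aut_expz_succ IHn.
Qed.

Lemma aut_expzNK a x : aut_expz f a (aut_expz f (- a)%R x) = x.
Proof.
have iterK n y : iter n f (iter n (aut_inv f) y) = y.
  by elim: n y => // n IHn y; rewrite iterSr [iter n.+1 (aut_inv f) y]iterS aut_invK.
have iterVK n y : iter n (aut_inv f) (iter n f y) = y.
  by elim: n y => // n IHn y; rewrite iterSr [iter n.+1 f y]iterS aut_funK.
case: a => [[|n]|n] //.
- by rewrite -NegzE; apply: iterK.
- by rewrite NegzE opprK; apply: (iterVK n.+1).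
Qed.

Lemma aut_expz_expgz a x b : aut_expz f a (expgz x b) = expgz (aut_expz f a x) b.
Proof.
have morX (h : automorphism G) y c : h (expgz y c) = expgz (h y) c.
  have hX n : h (y ^+ n) = h y ^+ n.
    by elim: n => [|n IHn]; rewrite ?expg0 ?aut1 // !expgS autM IHn.
  by case: c => n /=; rewrite ?autV hX.
have iterX (h : automorphism G) n y c : iter n h (expgz y c) = expgz (iter n h y) c.
  by elim: n => //= n ->.
case: a => n; first exact: iterX.
exact: (iterX (inverse_automorphism f) n.+1).
Qed.

Lemma lc_aut_expz i a x : lc i x -> lc i (aut_expz f a x).
Proof.
have lc_iter (h : automorphism G) n y : lc i y -> lc i (iter n h y).
  by move=> lcy; elim: n => //= n; apply: lc_aut.
case: a => n; first exact: lc_iter.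
exact: (lc_iter (inverse_automorphism f) n.+1).
Qed.

Lemma lc_expgz i x a : lc i x -> lc i (expgz x a).
Proof.
move=> lcx; have lcX n : lc i (x ^+ n).
  by elim: n => [|n IHn]; [exact: lc1 | rewrite expgS; apply: lcM].
by case: a => n //=; apply: lcV.
Qed.
End AutomorphismPowers.

Section InducedMap.
Variables (F : fieldType) (G : groupType) (L : presentation (@lie_relation F G)).
Variable f : automorphism G.
Local Notation lc := (@lower_central G).
Local Notation e := (lie_gen L).
Local Open Scope ring_scope.

Definition lie_map : L -> L := lie_lift (fun i x => e i (f x)).

Lemma lie_map_linear : linear_map lie_map.
Proof.
move=> a u v; apply: lie_lift_linear => [i x y lcx lcy|i x lcx].
  by rewrite autM lie_genM //; apply: lc_aut.
by apply/lie_genS/lc_aut.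
Qed.

Lemma lie_map_gen i x : lc i x -> lie_map (e i x) = e i (f x).
Proof.
move=> lcx; rewrite /lie_map lie_lift_gen // => [j y z lcy lcz|j y lcy].
  by rewrite autM lie_genM //; apply: lc_aut.
by apply/lie_genS/lc_aut.
Qed.

Lemma lie_map_br u v : lie_map (lie_br u v) = lie_br (lie_map u) (lie_map v).
Proof.
have brL := @lie_br_linear _ _ L; have brR := @lie_br_linearr _ _ L.
move: u; apply: lie_linear_ext.
- by move=> a u w; rewrite (brL v a) lie_map_linear.
- by move=> a u w; rewrite lie_map_linear (brL (lie_map v) a).
move=> i x lcx; move: v; apply: lie_linear_ext.
- by move=> a u w; rewrite (brR (e i x) a) lie_map_linear.
- by move=> a u w; rewrite lie_map_linear brR.
move=> j y lcy; have lcfx := lc_aut f lcx; have lcfy := lc_aut f lcy.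
rewrite lie_br_gen // !lie_map_gen // ?lie_br_gen ?autR //; exact: lc_comm.
Qed.

Lemma lie_map_iter n i x : lc i x -> iter n lie_map (e i x) = e i (iter n f x).
Proof.
move=> lcx; elim: n => //= n ->; apply: lie_map_gen.
exact: (@lc_aut_expz G f i n).
Qed.

Lemma lie_gen_expgz i x a : lc i x -> e i (expgz x a) = a%:~R *: e i x.
Proof.
move=> lcx; have lcX n : lc i (x ^+ n)%g by exact: (@lc_expgz G i x n).
have eX n : e i (x ^+ n)%g = n%:R *: e i x.
  elim: n => [|n IHn]; first by rewrite expg0 lie_gen1 scale0r.
  by rewrite expgS lie_genM // IHn -nat1r scalerDl scale1r.
by case: a => n /=; rewrite ?lie_genV // eX // NegzE mulrNz scaleNr.
Qed.

Lemma lie_gen_prod i k (g : 'I_k -> G) : (forall t, lc i (g t)) ->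
  e i (\prod_(t < k) g t)%g = \sum_(t < k) e i (g t).
Proof.
elim: k g => [|k IHk] g lcg; first by rewrite !big_ord0 lie_gen1.
rewrite !big_ord_recl lie_genM ?IHk //.
by elim: (index_enum _) => [|t s IHs]; rewrite ?big_nil ?big_cons; [exact: lc1 | apply: lcM].
Qed.
End InducedMap.

Lemma lie_map_inj (F : fieldType) (G : groupType) (L : presentation (@lie_relation F G))
  (f : automorphism G) : injective (lie_map (L := L) f).
Proof.
apply: (can_inj (g := lie_map (inverse_automorphism f))).
apply: lie_linear_ext => [a u v|//|i x lcx]; first by rewrite !lie_map_linear.
rewrite lie_map_gen // lie_map_gen; last exact: lc_aut.
by congr (lie_gen L i _); apply: aut_funK.
Qed.

Section IdentityPolynomial.
Local Open Scope ring_scope.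
Variables (k : nat) (m n : 'I_k -> int).

(* The Laurent polynomial of the identity divided by [z ^ m t0]. *)
Definition identity_poly (F : fieldType) (t0 : 'I_k) : {poly F} :=
  \sum_(t < k) (n t)%:~R *: 'X^(`|m t - m t0|%N).

Lemma size_identity_poly F t0 : (size (identity_poly F t0) <= (identity_degree m).+1)%N.
Proof.
apply: (leq_trans (size_sum _ _ _)); apply/bigmax_leqP => t _.
apply: (leq_trans (size_scale_leq _ _)); rewrite size_polyXn ltnS.
apply: leq_trans (leq_bigmax (F := fun s => \max_(t < k) `|m s - m t|%N) t).
exact: (leq_bigmax (F := fun t' => `|m t - m t'|%N)).
Qed.

Lemma identity_poly_act (F : fieldType) (G : groupType)
    (L : presentation (@lie_relation F G)) (f : automorphism G) t0 :
  (forall t, m t0 <= m t) -> satisfies_identity f m n ->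
  forall v, poly_act (lie_map (L := L) f) (identity_poly F t0) v = 0.
Proof.
move=> t0min fmn; have phiL := lie_map_linear (L := L) f.
have phiLn i := iter_linear i phiL.
have actL (p : {poly F}) : linear_map (poly_act (lie_map (L := L) f) p).
  move=> a u v; rewrite /poly_act scaler_sumr -big_split /=; apply: eq_bigr => i _.
  by rewrite phiLn scalerDr !scalerA mulrC.
apply: lie_linear_ext => // [a u v|i x lcx]; first by rewrite scaler0 addr0.
(* Evaluating the identity at this shifted point makes all exponents nonnegative, so that it becomes
   polynomial in f. *)
pose y := aut_expz f (- m t0) x; have lcy : lower_central i y by apply: lc_aut_expz.
rewrite -[RHS](lie_gen1 L i) (fmn y) lie_gen_prod => [|t]; last first.
  by apply/lc_aut_expz/lc_expgz.
have act_sum (r : seq 'I_k) (g : 'I_k -> {poly F}) v :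
    poly_act (lie_map f) (\sum_(t <- r) g t) v = \sum_(t <- r) poly_act (lie_map f) (g t) v.
  elim: r => [|t r IHr]; rewrite ?big_nil ?big_cons.
    exact: (linear_map0 (poly_act_linear _ v)).
  by rewrite (linear_mapD (poly_act_linear _ v)) IHr.
rewrite /identity_poly act_sum; apply: eq_bigr => t _.
rewrite (linear_mapZ _ (poly_act_linear _ _)) poly_actXn lie_map_iter //.
rewrite aut_expz_expgz lie_gen_expgz; last exact: lc_aut_expz.
have mt : m t = m t0 + `|m t - m t0|%N by rewrite gez0_abs ?subr_ge0 // [RHS]addrC subrK.
by rewrite [in RHS]mt aut_expzDn aut_expzNK.
Qed.

Lemma identity_polyE t0 (z : mulgroup algC) : (forall t, m t0 <= m t) ->
  mmap (@ratr algC) (fun i : int => (val z : algC) ^ i) (identity_laurent rat m n) =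
  (val z) ^ (m t0) * (identity_poly algC t0).[val z].
Proof.
move=> t0min; rewrite raddf_sum /= horner_sum mulr_sumr; apply: eq_bigr => t _.
rewrite mmapU /= ratr_int hornerZ hornerXn mulrCA; congr (_ * _).
have mt : m t = m t0 + `|m t - m t0|%N by rewrite gez0_abs ?subr_ge0 // [RHS]addrC subrK.
by rewrite [in LHS]mt expfzDr // (valP z).
Qed.
End IdentityPolynomial.

Section FamilySums.
Variables (K : fieldType) (L : zmodType) (br : L -> L -> L).
Hypothesis brDl : forall u v w, br (u + v) w = br u w + br v w.
Hypothesis brDr : forall u v w, br w (u + v) = br w u + br w v.
Implicit Types V W : family K L.

Lemma fam_sumN V u : additive_family V -> fam_sum V u -> fam_sum V (- u).
Proof.
move=> addV; elim=> [|a {}u v Vu _ Sv]; first by rewrite oppr0; apply: fam_sum0.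
by rewrite opprD; apply: fam_sumD Sv; apply: famN addV Vu.
Qed.

Lemma fam_sum_br V W u v : fam_sum V u -> fam_sum W v -> fam_sum (brspan br V W) (br u v).
Proof.
have br0 w : br 0 w = 0 by apply: (addrI (br 0 w)); rewrite -brDl !addr0.
have br0' w : br w 0 = 0 by apply: (addrI (br w 0)); rewrite -brDr !addr0.
elim=> [|a {}u w Vu _ Sw] Wv; first by rewrite br0; apply: fam_sum0.
rewrite brDl; apply: fam_sum_add; last exact: Sw.
clear Sw.
elim: Wv => [|b {}v z Wv _ Sz]; first by rewrite br0'; apply: fam_sum0.
by rewrite brDr; apply: fam_sumD Sz; apply: (@brspan_br _ _ _ _ _ a b _ _ _ (erefl _)).
Qed.

Lemma fam_sum_zero V u : (forall a v, V a v -> v = 0) -> fam_sum V u -> u = 0.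
Proof. by move=> V0; elim=> // a {}u v /V0-> _ ->; rewrite addr0. Qed.
End FamilySums.

(** A commutator with an arbitrary group element is a bracket with a generator of degree 0, so each
    degree costs one bracket with the whole algebra. *)
Lemma lie_gen_lcs (F : fieldType) (G : groupType) (L : presentation (@lie_relation F G))
    (V : family F L) : additive_family V -> (forall v, fam_sum V v) ->
  forall n x, lower_central n x -> fam_sum (lcs (@lie_br _ _ L) V V n) (lie_gen L n x).
Proof.
move=> addV sumV; elim=> [|n IHn] x lcx; first exact: sumV.
have addl : additive_family (lcs (@lie_br _ _ L) V V n.+1) by apply: brspan_add.
elim: lcx => {x} [_ [x [y [lcx ->]]]||x y lcx Sx lcy Sy|x lcx Sx].
- have -> : lie_gen L n.+1 [~ x, y]%g = lie_br (lie_gen L n x) (lie_gen L 0 y).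
    by rewrite lie_br_gen // addn0.
  by apply: fam_sum_br; [exact: lie_brDl | exact: lie_brDr | exact: IHn | exact: sumV].
- by rewrite lie_gen1; apply: fam_sum0.
- by rewrite lie_genM //; apply: fam_sum_add.
- by rewrite lie_genV //; apply: fam_sumN.
Qed.

Lemma mulgroup_algC_infinite (s : seq (mulgroup algC)) : exists z, z \notin s.
Proof.
pose g i : mulgroup algC := MulGroup (negbT (pnatr_eq0 algC i.+1)).
have gI : injective g.
  by move=> i j /(congr1 val)/eqP; rewrite /= eqr_nat eqSS => /eqP.
have [/allP gs|/allPn[z _ zs]] := boolP (all (mem s) (map g (iota 0 (size s).+1))); last by exists z.
have := uniq_leq_size _ gs; rewrite size_map size_iota ltnn.
by rewrite (map_inj_uniq gI) iota_uniq => /(_ isT).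
Qed.

Lemma val_expgz (y : mulgroup algC) i : val (expgz y i) = (val y) ^ i.
Proof.
have valX n : val (y ^+ n)%g = val y ^+ n.
  by elim: n => [|n IHn]; [rewrite expr0 | rewrite expgS exprS -IHn].
by case: i => n; rewrite /= ?valX.
Qed.

(* By the pigeonhole principle, [y] has finite order. *)
Lemma stable_int (K : fieldType) (X : seq K) a y : 0 \notin X ->
  (forall n, a * y ^+ n \in X) -> forall i : int, a * y ^ i \in X.
Proof.
move=> X0 aX.
have ay_neq0 n : a * y ^+ n != 0 by apply: contraNneq X0 => <-.
have y0 : y != 0 by have := ay_neq0 1%N; rewrite expr1 mulf_eq0 negb_or => /andP[].
have a0 : a != 0 by have := ay_neq0 0%N; rewrite mulr1.
pose g (i : 'I_(size X).+1) := a * y ^+ i.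
have [p p0 yp] : exists2 p, (0 < p)%N & y ^+ p = 1.
  have /injectivePn[i [j ij gij]] : ~~ injectiveb g.
    apply/negP => /injectiveP gI.
    have gX z : z \in map g (enum 'I_(size X).+1) -> z \in X by case/mapP=> i _ ->; apply: aX.
    have := uniq_leq_size _ gX; rewrite size_map size_enum_ord ltnn.
    by rewrite (map_inj_uniq gI) enum_uniq => /(_ isT).
  wlog ltij : i j ij gij / (i < j)%N.
    move=> wl; have /orP[lt|lt] : (i < j)%N || (j < i)%N by rewrite -neq_ltn.
      exact: (wl i j).
    by apply: (wl j i) => //; rewrite eq_sym.
  exists (j - i)%N; first by rewrite subn_gt0.
  apply: (mulfI (expf_neq0 i y0)); rewrite mulr1 -exprD subnKC ?(ltnW ltij) //.
  by apply/esym/(mulfI a0).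
case=> n; first exact: aX.
rewrite NegzE -exprnN.
suff -> : y ^- n.+1 = y ^+ (p.-1 * n.+1) by apply: aX.
apply: (mulfI (expf_neq0 n.+1 y0)); rewrite mulfV ?expf_neq0 // -exprD -mulSn.
by rewrite prednK // exprM yp expr1n.
Qed.

(** Successive powers of x descend to a trivial term of the series; torsion-freeness then gives x =
    1. *)
Lemma torsion_free_class (G : groupType) c : torsion_free G -> nilpotent_group G ->
  (forall n (x : G), (c <= n)%N -> lower_central n x ->
     exists2 m, (0 < m)%N & lower_central n.+1 (x ^+ m)%g) ->
  nilpotent_class_le G c.
Proof.
move=> Gtf [N GN] lcX x lcx.
have [m m0 lcm] : exists2 m, (0 < m)%N & lower_central (c + N) (x ^+ m)%g.
  elim: N {GN} => [|j [m m0 lcm]]; first by exists 1%N; rewrite ?addn0.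
  have [m' m'0 lcm'] := lcX _ _ (leq_addr j c) lcm.
  by exists (m * m')%N; rewrite ?muln_gt0 ?m0 // expgnA addnS.
by apply: (Gtf x m m0); apply/GN/(lc_leq (leq_addl c N)).
Qed.

Section EigenvalueSet.
Variables (k : nat) (m n : 'I_k -> int) (d : nat).
Hypothesis deg_m : identity_degree m = d.
Hypothesis mn_free : arithmetically_free_over_rat m n.

Lemma min_exponent : exists t0 : 'I_k, forall t, m t0 <= m t.
Proof.
case: k m n mn_free => [|k'] m' n' m'n'_free; last first.
  by case: (@arg_minP _ _ _ ord0 xpredT m' isT) => t0 _ t0min; exists t0 => t; apply: t0min.
(* With no factors the Laurent polynomial is 0 and its roots form the whole multiplicative group,
   which is infinite. *)
have [[s sP] _] := m'n'_free; have [z /negP[]] := mulgroup_algC_infinite s.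
by apply: sP; rewrite /laurent_root /identity_laurent big_ord0 raddf0.
Qed.

Lemma eigenvalue_set : exists (t0 : 'I_k) (X : seq algC),
  [/\ forall t, m t0 <= m t, (size X <= d)%N, 0 \notin X, 1 \notin X &
     [/\ identity_poly m n algC t0 != 0, good_ordering X,
     (forall a y, a \in X -> y \in X -> ~ (forall i, a * y ^+ i \in X)) &
     forall a, a != 0 -> a \notin X -> ~~ root (identity_poly m n algC t0) a]].
Proof.
have [t0 t0min] := min_exponent; exists t0.
pose P := identity_poly m n algC t0.
pose lroot := laurent_root (@ratr algC) (identity_laurent rat m n).
have lrootE z : lroot z <-> root P (val z).
  rewrite /lroot /laurent_root (identity_polyE _ _ t0min).
  split=> [/eqP|/eqP->]; last by rewrite mulr0.
  by rewrite mulf_eq0 expfz_eq0 (negPf (valP z)) andbF.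
have [[s sP] free] := mn_free.
have P0 : P != 0.
  apply/eqP => P0; have [z /negP[]] := mulgroup_algC_infinite s.
  by apply: sP; apply/lrootE; rewrite P0 root0.
have [rs Prs] := closed_field_poly_normal P.
have Proot a : root P a = (a \in rs).
  by rewrite Prs rootZ ?lead_coef_eq0 // root_prod_XsubC.
pose X := undup [seq a <- rs | a != 0].
have memX a : (a \in X) = (a != 0) && root P a.
  by rewrite mem_undup mem_filter Proot.
have X0 : 0 \notin X by rewrite memX eqxx.
have szX : (size X <= d)%N.
  apply: (leq_trans (size_undup _)); rewrite size_filter.
  apply: (leq_trans (count_size _ _)); rewrite -ltnS.
  have <- : size P = (size rs).+1 by rewrite Prs size_scale ?lead_coef_eq0 // size_prod_XsubC.
  by rewrite -deg_m; apply: size_identity_poly.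
have Xfree a y : a \in X -> y \in X -> ~ (forall i, a * y ^+ i \in X).
  move=> Xa Xy aX; have aXi := stable_int X0 aX.
  move: (Xa) (Xy); rewrite !memX => /andP[a0 ra] /andP[y0 ry].
  apply: free; exists (MulGroup a0), (MulGroup y0); split; [exact/lrootE|exact/lrootE|].
  move=> i; apply/lrootE; have := aXi i; rewrite memX => /andP[_].
  by rewrite /= val_expgz.
have X1 : 1 \notin X.
  by apply/negP => X1; apply: (Xfree 1 1) => // i; rewrite expr1n mulr1.
have [Y XY ordY] := good_ordering_exists X0 X1.
have memY := perm_mem XY; exists Y; split=> //; rewrite -?(perm_size XY) -?memY //.
split=> // [a y|a a0]; rewrite -!memY.
  by move=> Xa Xy aY; apply: (Xfree a y) => // i; rewrite memY.
by rewrite memX a0.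
Qed.
End EigenvalueSet.

Theorem theorem5p6 (G : groupType) (d : nat)
    (G_fg : finitely_generated G) (G_tf : torsion_free G)
    (G_nil : nilpotent_group G)
    (G_aut : exists (f : automorphism G) (k : nat) (m n : 'I_k -> int),
        [/\ satisfies_identity f m n,
            identity_degree m = d
          & arithmetically_free_over_rat m n]) :
  nilpotent_class_le G (d ^ (2 ^ d))%N.
Proof.
case: G_aut => f [k [m [n [fmn deg_m mn_free]]]].
have [t0 [X [t0min szX X0 X1 [P0 ordX Xfree Xroot]]]] := eigenvalue_set deg_m mn_free.
have [L] := presentation_exists (@lie_relation algC G).
have phiL := lie_map_linear (L := L) f; pose phi := lie_map (L := L) f.
have Pphi := identity_poly_act (L := L) t0min fmn.
have gV : graded (@lie_br _ _ L) X (geig phi).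
  split; first exact: geig_add.
    by apply: (geig_br phiL); [exact: lie_br_linearr | exact: lie_br_linear | exact: lie_map_br].
  move=> a u au aX; have [a0|a0] := eqVneq a 0.
    by rewrite a0 in au; apply: (geig0 phiL (@lie_map_inj _ _ L f) au).
  exact: (geig_root phiL Pphi (Xroot a a0 aX) au).
have sumV v : fam_sum (geig phi) v.
  have [rs Prs] := closed_field_poly_normal (identity_poly m n algC t0).
  apply: (@poly_act_prod0 _ _ _ phiL rs); have /eqP := Pphi v.
  rewrite Prs (linear_mapZ _ (poly_act_linear _ v)) scaler_eq0 lead_coef_eq0 (negPf P0).
  by move/eqP.
have szc : (size X ^ (2 ^ size X) <= d ^ (2 ^ d))%N.
  (* For d = 0 the set X is empty and both sides are 0 ^ 1 = 0. *)
  case: d szX {deg_m} => [|d' szX]; first by rewrite leqn0 => /eqP->.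
  apply: (@leq_trans (d'.+1 ^ (2 ^ size X))); first by rewrite leq_exp2r // expn_gt0.
  by rewrite leq_pexp2l // leq_pexp2l.
apply: torsion_free_class => // i x ci lcx; apply: (lie_gen_torsion (L := L) lcx).
have := lie_gen_lcs (geig_add phiL) sumV lcx.
apply: fam_sum_zero => a v.
(* The brackets counted by [graded_nilpotent] already give 0, and the further ones keep it. *)
rewrite -(subnKC (leq_trans szc ci)) lcsD.
have nilV := graded_nilpotent (@lie_brDl _ _ L) (@lie_brDr _ _ L) (@lie_brC _ _ L)
  (@lie_brJ _ _ L) X0 X1 ordX Xfree gV.
move: (i - _)%N a v; elim=> [|j IHj] a v; first exact: nilV.
apply: (@brspan_min _ _ _ _ _ (fun _ v => v = 0)).
  by split=> // b u w -> ->; rewrite subrr.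
by move=> b c u w /IHj-> _; apply: (linear_map0 (lie_br_linear w)).
Qed.
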